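(* Let $H$ be a separable Hilbert space, $2\le p<\infty$, and $T$ a bounded linear operator on $H$ (not assumed compact). The following are equivalent: (i) $T\in S_p$; (ii) there is $C>0$ with $\sum_{n=1}^\infty\sum_{k=1}^\infty|\langle Te_n,e_k\rangle|^p\le C$ for every orthonormal basis $\{e_n\}$; (iii) there is $C>0$ with $\sum_{n=1}^\infty\sum_{k=1}^\infty|\langle Tf_n,f_k\rangle|^p\le C$ for every frame $\{f_n\}$ with upper frame bound at most $1$.
   Context: A sequence $\{f_n\}$ in $H$ is a frame if there are constants $0<C_1\le C_2$ such that $C_1\|f\|^2\le\sum_n|\langle f,f_n\rangle|^2\le C_2\|f\|^2$ for all $f\in H$. The upper frame bound is the infimum of all admissible $C_2$. For a compact operator $T$, its singular values $\lambda_1\ge\lambda_2\ge\cdots$ are the positive eigenvalues of $(T^*T)^{1/2}$, repeated according to multiplicity. For $0<p<\infty$, $S_p$ is the set of compact $T$ with $\{\lambda_n\}\in\ell^p$. *)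

(* Defs.v *)
From Stdlib Require Import Reals.
Open Scope R_scope.
Set Implicit Arguments.

Record Cplx := mkC { re : R; im : R }.
Definition C0 : Cplx := mkC 0 0.
Definition C1 : Cplx := mkC 1 0.
Definition Cadd (a b : Cplx) : Cplx := mkC (re a + re b) (im a + im b).
Definition Copp (a : Cplx) : Cplx := mkC (- re a) (- im a).
Definition Cmul (a b : Cplx) : Cplx :=
  mkC (re a * re b - im a * im b) (re a * im b + im a * re b).
Definition Cconj (a : Cplx) : Cplx := mkC (re a) (- im a).
Definition Cnorm2 (a : Cplx) : R := re a * re a + im a * im a.
Definition Cabs (a : Cplx) : R := sqrt (Cnorm2 a).

Record Hilbert := {
  hcar :> Type;
  hadd : hcar -> hcar -> hcar;
  hzero : hcar;
  hopp : hcar -> hcar;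
  hscal : Cplx -> hcar -> hcar;
  inner : hcar -> hcar -> Cplx;
  hadd_assoc : forall x y z, hadd x (hadd y z) = hadd (hadd x y) z;
  hadd_comm : forall x y, hadd x y = hadd y x;
  hadd_zero : forall x, hadd x hzero = x;
  hadd_opp : forall x, hadd x (hopp x) = hzero;
  hscal_one : forall x, hscal C1 x = x;
  hscal_assoc : forall a b x, hscal a (hscal b x) = hscal (Cmul a b) x;
  hscal_distr_v : forall a x y, hscal a (hadd x y) = hadd (hscal a x) (hscal a y);
  hscal_distr_s : forall a b x, hscal (Cadd a b) x = hadd (hscal a x) (hscal b x);
  inner_add_l : forall x y z, inner (hadd x y) z = Cadd (inner x z) (inner y z);
  inner_scal_l : forall a x y, inner (hscal a x) y = Cmul a (inner x y);
  inner_conj_sym : forall x y, inner y x = Cconj (inner x y);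
  inner_pos : forall x, 0 <= re (inner x x);
  inner_def : forall x, inner x x = C0 -> x = hzero;
  hcomplete : forall u : nat -> hcar,
    (forall eps, 0 < eps -> exists N, forall m n, (N <= m)%nat -> (N <= n)%nat ->
        sqrt (re (inner (hadd (u m) (hopp (u n))) (hadd (u m) (hopp (u n))))) < eps) ->
    exists l, forall eps, 0 < eps -> exists N, forall n, (N <= n)%nat ->
        sqrt (re (inner (hadd (u n) (hopp l)) (hadd (u n) (hopp l)))) < eps;
  hseparable : exists d : nat -> hcar, forall x eps, 0 < eps -> exists n,
        sqrt (re (inner (hadd x (hopp (d n))) (hadd x (hopp (d n))))) < eps
}.

Arguments hadd {h}. Arguments hzero {h}. Arguments hopp {h}.
Arguments hscal {h}. Arguments inner {h}.

Section Ops.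
Context {H : Hilbert}.

Definition hnorm (x : H) : R := sqrt (re (inner x x)).
Definition hsub (x y : H) : H := hadd x (hopp y).
Definition hscalR (r : R) (x : H) : H := hscal (mkC r 0) x.

Definition bounded_linear (T : H -> H) : Prop :=
  (forall x y, T (hadd x y) = hadd (T x) (T y)) /\
  (forall a x, T (hscal a x) = hscal a (T x)) /\
  (exists M, forall x, hnorm (T x) <= M * hnorm x).

Definition converges (u : nat -> H) (l : H) : Prop :=
  forall eps, 0 < eps -> exists N, forall n, (N <= n)%nat -> hnorm (hsub (u n) l) < eps.

Definition compact_op (T : H -> H) : Prop :=
  forall u : nat -> H, (exists M, forall n, hnorm (u n) <= M) ->
  exists phi : nat -> nat, (forall n, (phi n < phi (S n))%nat) /\
    exists l, converges (fun n => T (u (phi n))) l.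

Fixpoint rsum (n : nat) (f : nat -> R) : R :=
  match n with O => 0 | S n' => rsum n' f + f n' end.

(** x^p for x >= 0 and real p > 0, with 0^p = 0 *)
Definition rpow (x p : R) : R := if Req_EM_T x 0 then 0 else Rpower x p.

(** S is the positive square root (T^* T)^{1/2} of T^* T *)
Definition is_abs_op (T S : H -> H) : Prop :=
  bounded_linear S /\
  (forall x y, inner (S x) y = inner x (S y)) /\
  (forall x, 0 <= re (inner (S x) x)) /\
  (forall x y, inner (S (S x)) y = inner (T x) (T y)).

(** T in S_p: T compact and its singular values (positive eigenvalues of
    |T| = (T^*T)^{1/2}, repeated according to multiplicity) are p-summable.
    Summing with multiplicity = summing over finite orthonormal families of
    eigenvectors of |T| with positive eigenvalues. *)
Definition in_Sp (p : R) (T : H -> H) : Prop :=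
  compact_op T /\
  exists S, is_abs_op T S /\
  exists B, forall (m : nat) (u : nat -> H) (lam : nat -> R),
    (forall i j, (i < m)%nat -> (j < m)%nat ->
        inner (u i) (u j) = if Nat.eq_dec i j then C1 else C0) ->
    (forall i, (i < m)%nat -> 0 < lam i /\ S (u i) = hscalR (lam i) (u i)) ->
    rsum m (fun i => rpow (lam i) p) <= B.

Definition orthonormal_basis (e : nat -> H) : Prop :=
  (forall n m, inner (e n) (e m) = if Nat.eq_dec n m then C1 else C0) /\
  (forall x, (forall n, inner x (e n) = C0) -> x = hzero).

Definition upper_frame_const (f : nat -> H) (C2 : R) : Prop :=
  forall x, exists l, infinite_sum (fun n => Cnorm2 (inner x (f n))) l /\
    l <= C2 * (hnorm x * hnorm x).

Definition is_frame (f : nat -> H) : Prop :=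
  exists C1 C2, 0 < C1 <= C2 /\
  forall x, exists l, infinite_sum (fun n => Cnorm2 (inner x (f n))) l /\
    C1 * (hnorm x * hnorm x) <= l /\ l <= C2 * (hnorm x * hnorm x).

(** the upper frame bound (infimum of admissible C2) is at most b *)
Definition upper_frame_bound_le (f : nat -> H) (b : R) : Prop :=
  forall eps, 0 < eps -> exists C2, upper_frame_const f C2 /\ C2 < b + eps.

(** sum_n sum_k |<T g_n, g_k>|^p <= C  (series of nonnegative terms) *)
Definition double_sum_le (T : H -> H) (g : nat -> H) (p C : R) : Prop :=
  forall N K : nat,
    rsum N (fun n => rsum K (fun k => rpow (Cabs (inner (T (g n)) (g k))) p)) <= C.

End Ops.

(* Main.v *)
(** The frame condition implies the basis condition because, by Parseval, an
    orthonormal basis is a frame with both bounds 1.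

    If [T] is in the Schatten class, let [u_i] be right singular vectors and [s_i]
    the singular values.  As [p >= 2], for a frame [f] with upper bound 1 the inner
    sum over [k] is at most [|T f_n|^p], and Jensen's inequality applied to
    [|T f_n|^2 = sum_i s_i^2 |<f_n, u_i>|^2] with exponent [p/2] bounds the sum over
    [n] by [sum_i s_i^p].  The singular vectors are found by maximizing [|T x|]
    successively, which needs no adjoint.

    Conversely, the diagonal terms of the sums over bases bound
    [sum |<T x_i, x_i>|^p] over all finite orthonormal families.  Choose [e_n]
    greedily so that [|<T x, x>| <= 2 w_n |x|^2] for [x] orthogonal to
    [e_0, ..., e_(n-1)], where [w_n = |<T e_n, e_n>|].  By polarization the
    compression of [T] to that orthogonal complement has norm at most [4 w_n].
    Hence [T] is compact, and as the compression differs from [T] by a rank [2n]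
    operator, the singular value of index [2n] is at most [4 w_n]; the [w_n] are
    [p]-summable. *)

Require Import Defs.
From Stdlib Require Import Reals Lra Lia Arith List Classical ClassicalEpsilon Ring.
(* [Reals] also exports a [C1]. *)
Import Defs.
Open Scope R_scope.

(** * Complex numbers *)

(** The hypothesis on bases controls entries of T taken along one orthonormal family, whereas a
    singular value pairs two families, <T u_i, v_i>. This is why the converse chooses its vectors by
    the quadratic form <Tx,x> and only afterwards passes to norms by polarization. At that stage T
    is not known to be compact, so the supremum of |<Tx,x>| need not be attained; the factor 2 buys
    a vector within half of it. The operator T^*T is never formed. Its eigenvalue equation is read
    through the form <Tx,Ty>, and |T| is built as a pointwise limit of finite-rank operators.
    Infinite expansions are cut at a finite index with an exact orthogonal remainder, which the
    decreasing singular values control. An [orthonormal_basis] is indexed by all of [nat], so a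
    finite-dimensional H has none and the condition on bases is vacuous there. That case is settled
    by counting dimensions. *)

Lemma Cplx_ext (a b : Cplx) : re a = re b -> im a = im b -> a = b.
Proof. destruct a, b; simpl; intros; subst; reflexivity. Qed.

Definition Csub (a b : Cplx) : Cplx := Cadd a (Copp b).

Lemma Cplx_ring : ring_theory C0 C1 Cadd Cmul Csub Copp (@eq Cplx).
Proof.
  constructor; intros; try reflexivity; apply Cplx_ext; simpl; ring.
Qed.
Add Ring CplxRing : Cplx_ring.

Lemma Cconj_add a b : Cconj (Cadd a b) = Cadd (Cconj a) (Cconj b).
Proof. apply Cplx_ext; simpl; ring. Qed.
Lemma Cconj_mul a b : Cconj (Cmul a b) = Cmul (Cconj a) (Cconj b).
Proof. apply Cplx_ext; simpl; ring. Qed.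
Lemma Cconj_opp a : Cconj (Copp a) = Copp (Cconj a).
Proof. apply Cplx_ext; simpl; ring. Qed.
Lemma Cconj_C0 : Cconj C0 = C0.
Proof. apply Cplx_ext; simpl; ring. Qed.

Lemma Cmul_conj a : Cmul a (Cconj a) = mkC (Cnorm2 a) 0.
Proof. apply Cplx_ext; unfold Cnorm2; simpl; ring. Qed.

Lemma Cnorm2_ge0 a : 0 <= Cnorm2 a.
Proof. unfold Cnorm2; nra. Qed.
Lemma Cnorm2_eq0 a : Cnorm2 a = 0 -> a = C0.
Proof. unfold Cnorm2; intros; apply Cplx_ext; simpl; nra. Qed.
Lemma Cnorm2_C0 : Cnorm2 C0 = 0.
Proof. unfold Cnorm2; simpl; ring. Qed.
Lemma Cnorm2_mul a b : Cnorm2 (Cmul a b) = Cnorm2 a * Cnorm2 b.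
Proof. unfold Cnorm2; simpl; ring. Qed.
Lemma Cnorm2_conj a : Cnorm2 (Cconj a) = Cnorm2 a.
Proof. unfold Cnorm2; simpl; ring. Qed.

Lemma Cabs_ge0 a : 0 <= Cabs a.
Proof. apply sqrt_pos. Qed.
Lemma Cabs_sqr a : Cabs a * Cabs a = Cnorm2 a.
Proof. apply sqrt_sqrt, Cnorm2_ge0. Qed.
Lemma Cabs_C0 : Cabs C0 = 0.
Proof. unfold Cabs; rewrite Cnorm2_C0; apply sqrt_0. Qed.
Lemma Cabs_mul a b : Cabs (Cmul a b) = Cabs a * Cabs b.
Proof. unfold Cabs; rewrite Cnorm2_mul; apply sqrt_mult; apply Cnorm2_ge0. Qed.
Lemma Cabs_opp a : Cabs (Copp a) = Cabs a.
Proof. unfold Cabs, Cnorm2; simpl; f_equal; ring. Qed.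
Lemma re_le_Cabs a : Rabs (re a) <= Cabs a.
Proof.
  apply Rsqr_incr_0_var; [|apply Cabs_ge0].
  rewrite <- Rsqr_abs; unfold Rsqr; rewrite Cabs_sqr; unfold Cnorm2; nra.
Qed.
Lemma im_le_Cabs a : Rabs (im a) <= Cabs a.
Proof.
  apply Rsqr_incr_0_var; [|apply Cabs_ge0].
  rewrite <- Rsqr_abs; unfold Rsqr; rewrite Cabs_sqr; unfold Cnorm2; nra.
Qed.
Lemma Cabs_add a b : Cabs (Cadd a b) <= Cabs a + Cabs b.
Proof.
  pose proof (Cabs_ge0 a); pose proof (Cabs_ge0 b).
  apply Rsqr_incr_0_var; [|lra]; unfold Rsqr.
  assert (K : re a * re b + im a * im b <= Cabs a * Cabs b).
  { replace (re a * re b + im a * im b) with (re (Cmul a (Cconj b))) by (simpl; ring).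
    eapply Rle_trans; [apply RRle_abs|].
    eapply Rle_trans; [apply re_le_Cabs|].
    rewrite Cabs_mul; right; f_equal; unfold Cabs; rewrite Cnorm2_conj; reflexivity. }
  pose proof (Cabs_sqr a); pose proof (Cabs_sqr b).
  rewrite Cabs_sqr; unfold Cnorm2 in *; simpl; nra.
Qed.

(** The junk value is [Cinv C0 = C0]. *)
Definition Cinv (a : Cplx) : Cplx := mkC (re a / Cnorm2 a) (- im a / Cnorm2 a).
Lemma Cinv_l a : a <> C0 -> Cmul (Cinv a) a = C1.
Proof.
  intros Ha. assert (K : Cnorm2 a <> 0) by (intros K; apply Ha, Cnorm2_eq0, K).
  apply Cplx_ext; simpl; unfold Cnorm2 in *; field; exact K.
Qed.

Fixpoint csum (n : nat) (f : nat -> Cplx) : Cplx :=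
  match n with O => C0 | S n' => Cadd (csum n' f) (f n') end.

Lemma csum_ext n f g : (forall i, (i < n)%nat -> f i = g i) -> csum n f = csum n g.
Proof. induction n; intros E; simpl; [reflexivity|]; rewrite IHn, E; auto. Qed.
Lemma csum_add n f g : csum n (fun i => Cadd (f i) (g i)) = Cadd (csum n f) (csum n g).
Proof. induction n; simpl; [ring|rewrite IHn; ring]. Qed.
Lemma csum_mul n a f : csum n (fun i => Cmul a (f i)) = Cmul a (csum n f).
Proof. induction n; simpl; [ring|rewrite IHn; ring]. Qed.
Lemma csum_conj n f : Cconj (csum n f) = csum n (fun i => Cconj (f i)).
Proof. induction n; simpl; [apply Cconj_C0|]; rewrite Cconj_add, IHn; reflexivity. Qed.
Lemma csum_0 n f : (forall i, (i < n)%nat -> f i = C0) -> csum n f = C0.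
Proof. induction n; intros E; simpl; [reflexivity|]; rewrite IHn, E; auto; ring. Qed.
Lemma csum_single n k f : (k < n)%nat ->
  (forall i, (i < n)%nat -> i <> k -> f i = C0) -> csum n f = f k.
Proof.
  induction n; intros Hk E; [lia|]; simpl.
  destruct (Nat.eq_dec k n) as [->|Hkn].
  - rewrite csum_0; [ring|]; intros i Hi; apply E; lia.
  - rewrite IHn, (E n); try lia; [ring|]; intros; apply E; lia.
Qed.
Lemma csum_re n f : re (csum n f) = rsum n (fun i => re (f i)).
Proof. induction n; simpl; [reflexivity|rewrite IHn; reflexivity]. Qed.

(** Gaussian elimination: a homogeneous system with fewer equations than unknowns has a nonzero
    solution. The list holds the equations, each given by its coefficients; the induction removes
    the last unknown. *)
Lemma linear_system (m : nat) : forall l : list (nat -> Cplx), (length l < m)%nat ->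
  exists c : nat -> Cplx, (exists i, (i < m)%nat /\ c i <> C0) /\
    forall phi, In phi l -> csum m (fun i => Cmul (c i) (phi i)) = C0.
Proof.
  assert (C10 : C1 <> C0) by (intros E; apply (f_equal re) in E; simpl in E; lra).
  induction m as [|m IH]; intros l Hl; [lia|].
  destruct (classic (exists phi, In phi l /\ phi m <> C0)) as [[phi [Hin Hphi]]|Hno].
  - destruct (in_split _ _ Hin) as [l1 [l2 ->]].
    (* Subtracts the multiple of the pivot [phi] that kills coefficient [m] of [psi]. The solution
       of the smaller system is then extended by the value of unknown [m] that [phi] dictates. *)
    pose (elim := fun (psi : nat -> Cplx) i =>
      Csub (psi i) (Cmul (Cmul (psi m) (Cinv (phi m))) (phi i))).
    destruct (IH (map elim (l1 ++ l2))) as [c [[i0 [Hi0 Hc]] Hs]].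
    { rewrite length_map; rewrite !length_app in *; simpl in *; lia. }
    pose (sg := csum m (fun i => Cmul (c i) (phi i))).
    pose (c' := fun i => if Nat.eq_dec i m then Copp (Cmul sg (Cinv (phi m))) else c i).
    assert (Hc' : forall psi, csum (S m) (fun i => Cmul (c' i) (psi i)) =
        Csub (csum m (fun i => Cmul (c i) (psi i))) (Cmul (Cmul sg (Cinv (phi m))) (psi m))).
    { intros psi; simpl.
      rewrite (csum_ext m _ (fun i => Cmul (c i) (psi i))).
      - unfold c'; destruct (Nat.eq_dec m m); [|congruence]; ring.
      - intros i Hi; unfold c'; destruct (Nat.eq_dec i m); [lia|reflexivity]. }
    exists c'; split.
    + exists i0; split; [lia|]; unfold c'; destruct (Nat.eq_dec i0 m); [lia|exact Hc].
    + assert (Hphi0 : csum (S m) (fun i => Cmul (c' i) (phi i)) = C0).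
      { rewrite Hc'; fold sg.
        replace (Cmul (Cmul sg (Cinv (phi m))) (phi m))
          with (Cmul sg (Cmul (Cinv (phi m)) (phi m))) by ring.
        rewrite Cinv_l by exact Hphi; ring. }
      intros psi Hpsi.
      assert (Hcase : psi = phi \/ In psi (l1 ++ l2)).
      { apply in_app_or in Hpsi; destruct Hpsi as [?|[?|?]];
          [right; apply in_or_app; auto|left; auto|right; apply in_or_app; auto]. }
      destruct Hcase as [->|Hin']; [exact Hphi0|].
      specialize (Hs (elim psi) (in_map elim _ _ Hin')).
      rewrite Hc'.
      rewrite (csum_ext m _ (fun i => Cadd (Cmul (c i) (psi i))
        (Cmul (Copp (Cmul (psi m) (Cinv (phi m)))) (Cmul (c i) (phi i))))) in Hs
        by (intros; unfold elim; ring).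
      rewrite csum_add, csum_mul in Hs; fold sg in Hs.
      rewrite <- Hs; ring.
  (* No equation involves unknown [m], so the unit vector in that coordinate solves all of them. *)
  - exists (fun i => if Nat.eq_dec i m then C1 else C0); split.
    + exists m; split; [lia|]; destruct (Nat.eq_dec m m); [exact C10|congruence].
    + intros phi Hin; rewrite (csum_single (S m) m); [|lia|].
      * destruct (Nat.eq_dec m m); [|congruence].
        destruct (classic (phi m = C0)) as [->|]; [ring|exfalso; eauto].
      * intros i _ Hi; destruct (Nat.eq_dec i m); [congruence|ring].
Qed.

(** * Real sums and powers *)

Lemma rsum_ext n f g : (forall i, (i < n)%nat -> f i = g i) -> rsum n f = rsum n g.
Proof. induction n; intros E; simpl; [reflexivity|]; rewrite IHn, E; auto. Qed.
Lemma rsum_le n f g : (forall i, (i < n)%nat -> f i <= g i) -> rsum n f <= rsum n g.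
Proof.
  induction n; intros E; simpl; [lra|]; apply Rplus_le_compat; auto.
Qed.
Lemma rsum_add n f g : rsum n (fun i => f i + g i) = rsum n f + rsum n g.
Proof. induction n; simpl; [ring|rewrite IHn; ring]. Qed.
Lemma rsum_mul n a f : rsum n (fun i => a * f i) = a * rsum n f.
Proof. induction n; simpl; [ring|rewrite IHn; ring]. Qed.
Lemma rsum_const n a : rsum n (fun _ => a) = INR n * a.
Proof. induction n; [simpl; ring|]; rewrite S_INR; simpl rsum; rewrite IHn; ring. Qed.
Lemma rsum_ge0 n f : (forall i, (i < n)%nat -> 0 <= f i) -> 0 <= rsum n f.
Proof. induction n; intros E; simpl; [lra|]; apply Rplus_le_le_0_compat; auto. Qed.
Lemma rsum_le_idx n m f : (n <= m)%nat -> (forall i, (i < m)%nat -> 0 <= f i) ->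
  rsum n f <= rsum m f.
Proof.
  induction 1 as [|m Hm IH]; intros E; [lra|]; simpl.
  pose proof (E m (Nat.lt_succ_diag_r m)).
  assert (rsum n f <= rsum m f) by (apply IH; intros; apply E; lia). lra.
Qed.
Lemma rsum_term n k f : (k < n)%nat -> (forall i, (i < n)%nat -> 0 <= f i) -> f k <= rsum n f.
Proof.
  intros Hk E; apply Rle_trans with (rsum (S k) f); [|apply rsum_le_idx; [lia|exact E]].
  simpl; assert (0 <= rsum k f) by (apply rsum_ge0; intros; apply E; lia); lra.
Qed.
Lemma rsum_exchange n m f :
  rsum n (fun i => rsum m (fun j => f i j)) = rsum m (fun j => rsum n (fun i => f i j)).
Proof.
  induction n; simpl; [|rewrite IHn, <- rsum_add; reflexivity].
  symmetry; rewrite (rsum_const m 0); ring.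
Qed.
Lemma rsum_lt n f g : (forall i, (i < n)%nat -> f i <= g i) ->
  (exists i, (i < n)%nat /\ f i < g i) -> rsum n f < rsum n g.
Proof.
  induction n; intros E [i [Hi Hlt]]; [lia|]; simpl.
  destruct (Nat.eq_dec i n) as [->|Hne].
  - apply Rplus_le_lt_compat; [apply rsum_le; auto|exact Hlt].
  - apply Rplus_lt_le_compat; [apply IHn; eauto; exists i; split; [lia|auto]|auto].
Qed.
Lemma sum_f_R0_rsum f n : sum_f_R0 f n = rsum (S n) f.
Proof. induction n; simpl in *; [ring|rewrite IHn; reflexivity]. Qed.

(** Deletes entry [k] of a family of length [n + 1] by moving the last entry into its place. *)
Definition drop_at {A : Type} (n k : nat) (f : nat -> A) (i : nat) : A :=
  f (if Nat.eq_dec i k then n else i).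
Lemma rsum_drop_at n k f : (k <= n)%nat -> rsum (S n) f = rsum n (drop_at n k f) + f k.
Proof.
  unfold drop_at; intros Hk; destruct (Nat.eq_dec k n) as [->|Hne].
  - simpl; f_equal; apply rsum_ext; intros i Hi; destruct (Nat.eq_dec i n); [lia|reflexivity].
  - simpl. assert (Hlt : (k < n)%nat) by lia; clear Hk Hne.
    enough (forall m, (m <= n)%nat ->
      rsum m (fun i => f (if Nat.eq_dec i k then n else i))
        = rsum m f + (if le_lt_dec m k then 0 else f n - f k)) as K.
    { rewrite (K n) by lia; destruct (le_lt_dec n k); [lia|ring]. }
    induction m; intros Hm; cbn [rsum]; [destruct (le_lt_dec 0 k); [ring|lia]|].
    rewrite IHm by lia.
    destruct (Nat.eq_dec m k), (le_lt_dec m k), (le_lt_dec (S m) k); try lia;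
      subst; ring.
Qed.

(** [Nat.div2] takes each value at most twice. This is the price of indexing singular values by 2n
    instead of n. *)
Lemma rsum_div2 (m : nat) (g : nat -> R) : (forall i, 0 <= g i) ->
  rsum m (fun i => g (Nat.div2 i)) <= 2 * rsum m g.
Proof.
  intros Hg.
  apply Rle_trans with (rsum (2 * m) (fun i => g (Nat.div2 i))).
  { apply rsum_le_idx; [lia|auto]. }
  right; induction m as [|m IH]; [simpl; ring|].
  replace (2 * S m)%nat with (S (S (2 * m))) by lia.
  change (rsum (S (S (2*m))) (fun i => g (Nat.div2 i)))
    with (rsum (2 * m) (fun i => g (Nat.div2 i)) + g (Nat.div2 (2 * m)) + g (Nat.div2 (S (2 * m)))).
  rewrite IH, Nat.div2_double, Nat.div2_succ_double; simpl rsum; ring.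
Qed.

(** * Powers with a real exponent and their convexity *)

Lemma rpow_0 q : rpow 0 q = 0.
Proof. unfold rpow; destruct (Req_EM_T 0 0); [reflexivity|congruence]. Qed.
Lemma rpow_pos x q : 0 < x -> rpow x q = Rpower x q.
Proof. intros; unfold rpow; destruct (Req_EM_T x 0); [lra|reflexivity]. Qed.
Lemma rpow_ge0 x q : 0 <= rpow x q.
Proof. unfold rpow; destruct (Req_EM_T x 0); [lra|left; apply exp_pos]. Qed.
Lemma rpow_gt0 x q : 0 < x -> 0 < rpow x q.
Proof. intros; rewrite rpow_pos by assumption; apply exp_pos. Qed.
Lemma rpow_le x y q : 0 < q -> 0 <= x -> x <= y -> rpow x q <= rpow y q.
Proof.
  intros Hq Hx Hxy; destruct Hx as [Hx| <-]; [|rewrite rpow_0; apply rpow_ge0].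
  rewrite !rpow_pos by lra; apply Rle_Rpower_l; lra.
Qed.
Lemma rpow_mult x y q : 0 <= x -> 0 <= y -> rpow (x * y) q = rpow x q * rpow y q.
Proof.
  intros [Hx| <-] [Hy| <-]; rewrite ?Rmult_0_l, ?Rmult_0_r, ?rpow_0; try ring.
  rewrite !rpow_pos by nra; symmetry; apply Rpower_mult_distr; assumption.
Qed.
Lemma rpow_sqr x q : 0 <= x -> rpow (x * x) (q / 2) = rpow x q.
Proof.
  intros [Hx| <-]; [|rewrite Rmult_0_l, !rpow_0; reflexivity].
  rewrite !rpow_pos by nra; rewrite <- Rpower_mult_distr by assumption.
  rewrite <- Rpower_plus; f_equal; field.
Qed.

Lemma Rpower_bernoulli z q : 0 < z -> 1 <= q -> 1 + q * (z - 1) <= Rpower z q.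
Proof.
  intros Hz Hq; unfold Rpower; set (t := ln z).
  assert (Ez : z = exp t) by (unfold t; symmetry; apply exp_ln; exact Hz).
  (* tangent line of exp at t, evaluated at q t and at 0 *)
  assert (A : exp t * (1 + (q * t - t)) <= exp (q * t)).
  { replace (q * t) with (t + (q * t - t)) at 2 by ring; rewrite exp_plus.
    apply Rmult_le_compat_l; [left; apply exp_pos|apply exp_ineq1_le]. }
  assert (B : exp t * (1 + - t) <= 1).
  { replace 1 with (exp t * exp (- t)) at 2
      by (rewrite <- exp_plus, <- exp_0; f_equal; ring).
    apply Rmult_le_compat_l; [left; apply exp_pos|apply exp_ineq1_le]. }
  (* With z = exp t, [B] gives z t >= z - 1; inserted in [A], z + (q - 1) z t >= z + (q - 1)(z - 1)
     = 1 + q (z - 1). *)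
  rewrite Ez. nra.
Qed.

(** Multiplied by [y] so that [y = 0] needs no separate treatment. *)
Lemma rpow_tangent x y q : 1 <= q -> 0 <= x -> 0 <= y ->
  rpow y q * (y + q * (x - y)) <= y * rpow x q.
Proof.
  intros Hq Hx [Hy| <-]; [|rewrite rpow_0; lra].
  pose proof (rpow_gt0 y q Hy) as Hyq.
  destruct Hx as [Hx| <-].
  - pose proof (Rpower_bernoulli (x / y) q ltac:(apply Rdiv_lt_0_compat; lra) Hq) as K.
    assert (E : rpow x q = rpow y q * Rpower (x / y) q).
    { rewrite <- (rpow_pos (x / y)) by (apply Rdiv_lt_0_compat; lra).
      rewrite <- rpow_mult; [f_equal; field; lra|lra|].
      left; apply Rdiv_lt_0_compat; lra. }
    rewrite E.
    assert (y + q * (x - y) <= y * Rpower (x / y) q).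
    { apply Rmult_le_compat_l with (r := y) in K; [|lra].
      replace (y * (1 + q * (x / y - 1))) with (y + q * (x - y)) in K by (field; lra).
      exact K. }
    nra.
  - rewrite rpow_0.
    assert (y + q * (0 - y) <= 0) by nra. nra.
Qed.

(** Averages the tangent line at the mean y. The weights may sum to less than 1: the missing mass
    sits at 0, where the power vanishes, and leaves the nonnegative slack (q - 1)(1 - sum t). *)
Lemma rpow_jensen n (t a : nat -> R) q : 1 <= q ->
  (forall i, (i < n)%nat -> 0 <= t i) -> (forall i, (i < n)%nat -> 0 <= a i) ->
  rsum n t <= 1 ->
  rpow (rsum n (fun i => t i * a i)) q <= rsum n (fun i => t i * rpow (a i) q).
Proof.
  intros Hq Ht Ha Hs; set (y := rsum n (fun i => t i * a i)).
  assert (Hy : 0 <= y) by (apply rsum_ge0; intros; apply Rmult_le_pos; auto).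
  assert (Hrhs : 0 <= rsum n (fun i => t i * rpow (a i) q)).
  { apply rsum_ge0; intros; apply Rmult_le_pos; auto; apply rpow_ge0. }
  destruct Hy as [Hy|Hy]; [|rewrite <- Hy, rpow_0; exact Hrhs].
  apply Rmult_le_reg_l with y; [exact Hy|].
  rewrite <- rsum_mul.
  apply Rle_trans with
    (rsum n (fun i => (rpow y q * (1 - q) * y) * t i + (rpow y q * q) * (t i * a i))).
  - rewrite rsum_add, !rsum_mul; fold y.
    pose proof (rpow_ge0 y q).
    replace (rpow y q * (1 - q) * y * rsum n t + rpow y q * q * y)
      with (y * rpow y q * (1 + (q - 1) * (1 - rsum n t))) by ring.
    assert (0 <= (q - 1) * (1 - rsum n t)) by (apply Rmult_le_pos; lra).
    assert (0 <= y * rpow y q) by (apply Rmult_le_pos; lra). nra.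
  - apply rsum_le; intros i Hi.
    pose proof (rpow_tangent (a i) y q Hq (Ha i Hi) (Rlt_le _ _ Hy)) as K.
    apply Rmult_le_compat_l with (r := t i) in K; [|auto].
    eapply Rle_trans; [|eapply Rle_trans; [exact K|]]; right; ring.
Qed.

(** Each a_i is at most X, hence a_i^q <= a_i X^(q-1), and the a_i sum to at most X. Applied with q
    = p/2 to squared coefficients, this is where the sum over k needs p >= 2. *)
Lemma rpow_superadditive n (a : nat -> R) X q : 1 <= q ->
  (forall i, (i < n)%nat -> 0 <= a i) -> rsum n a <= X ->
  rsum n (fun i => rpow (a i) q) <= rpow X q.
Proof.
  intros Hq Ha HX.
  assert (H0 : 0 <= rsum n a) by (apply rsum_ge0; auto).
  destruct (Rle_lt_dec X 0) as [HX0|HX0].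
  - assert (E : forall i, (i < n)%nat -> a i = 0).
    { intros i Hi; pose proof (rsum_term n i a Hi Ha); specialize (Ha i Hi); lra. }
    rewrite (rsum_ext n _ (fun _ => 0)), rsum_const, Rmult_0_r by
      (intros; rewrite E by assumption; apply rpow_0).
    apply rpow_ge0.
  - apply Rmult_le_reg_l with X; [exact HX0|].
    rewrite <- rsum_mul.
    apply Rle_trans with (rsum n (fun i => rpow X q * a i)).
    + apply rsum_le; intros i Hi.
      pose proof (rsum_term n i a Hi Ha); pose proof (Ha i Hi) as Hai.
      destruct Hai as [Hai|Hai]; [|rewrite <- Hai, rpow_0; lra].
      (* a^q / a is nondecreasing in a *)
      pose proof (rpow_tangent X (a i) q Hq ltac:(lra) ltac:(lra)) as K.
      assert (a i <= X) by lra.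
      pose proof (rpow_ge0 (a i) q).
      assert (rpow (a i) q * X <= rpow (a i) q * (a i + q * (X - a i))).
      { apply Rmult_le_compat_l; [assumption|nra]. }
      lra.
    + rewrite rsum_mul, (Rmult_comm X); apply Rmult_le_compat_l; [apply rpow_ge0|exact HX].
Qed.

(** * Inner product spaces *)

Definition nsq {H : Hilbert} (x : H) : R := re (inner x x).

Lemma inner_add_r {H : Hilbert} (x y z : H) : inner x (hadd y z) = Cadd (inner x y) (inner x z).
Proof.
  rewrite (inner_conj_sym _ (hadd y z) x), inner_add_l, Cconj_add, <- !inner_conj_sym; reflexivity.
Qed.
Lemma inner_scal_r {H : Hilbert} a (x y : H) : inner x (hscal a y) = Cmul (Cconj a) (inner x y).
Proof.
  rewrite (inner_conj_sym _ (hscal a y) x), inner_scal_l, Cconj_mul, <- inner_conj_sym; reflexivity.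
Qed.
Lemma inner_zero_l {H : Hilbert} (x : H) : inner hzero x = C0.
Proof.
  pose proof (inner_add_l _ hzero hzero x) as E; rewrite hadd_zero in E.
  transitivity (Csub (inner hzero x) (inner hzero x)); [rewrite E at 2; ring|ring].
Qed.
Lemma inner_zero_r {H : Hilbert} (x : H) : inner x hzero = C0.
Proof. rewrite inner_conj_sym, inner_zero_l; apply Cconj_C0. Qed.
Lemma inner_opp_l {H : Hilbert} (x y : H) : inner (hopp x) y = Copp (inner x y).
Proof.
  pose proof (inner_add_l _ x (hopp x) y) as E; rewrite hadd_opp, inner_zero_l in E.
  transitivity (Csub C0 (inner x y)); [rewrite E; ring|ring].
Qed.
Lemma inner_opp_r {H : Hilbert} (x y : H) : inner x (hopp y) = Copp (inner x y).
Proof. rewrite inner_conj_sym, inner_opp_l, Cconj_opp, <- inner_conj_sym; reflexivity. Qed.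
Lemma inner_sub_l {H : Hilbert} (x y z : H) : inner (hsub x y) z = Csub (inner x z) (inner y z).
Proof. unfold hsub; rewrite inner_add_l, inner_opp_l; reflexivity. Qed.
Lemma inner_sub_r {H : Hilbert} (x y z : H) : inner x (hsub y z) = Csub (inner x y) (inner x z).
Proof. unfold hsub; rewrite inner_add_r, inner_opp_r; reflexivity. Qed.

Ltac inner_simpl := repeat (first
  [ rewrite inner_add_l | rewrite inner_add_r | rewrite inner_scal_l | rewrite inner_scal_r
  | rewrite inner_sub_l | rewrite inner_sub_r | rewrite inner_opp_l | rewrite inner_opp_r
  | rewrite inner_zero_l | rewrite inner_zero_r ]).

Lemma im_inner_self {H : Hilbert} (x : H) : im (inner x x) = 0.
Proof. pose proof (f_equal im (inner_conj_sym _ x x)) as E; simpl in E; lra. Qed.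
Lemma inner_self {H : Hilbert} (x : H) : inner x x = mkC (nsq x) 0.
Proof. apply Cplx_ext; simpl; [reflexivity|apply im_inner_self]. Qed.
Lemma nsq_ge0 {H : Hilbert} (x : H) : 0 <= nsq x.
Proof. apply inner_pos. Qed.
Lemma nsq_eq0 {H : Hilbert} (x : H) : nsq x = 0 -> x = hzero.
Proof. intros E; apply inner_def; rewrite inner_self, E; reflexivity. Qed.
Lemma nsq_zero {H : Hilbert} : nsq (@hzero H) = 0.
Proof. unfold nsq; rewrite inner_zero_l; reflexivity. Qed.

Lemma hsub_eq0 {H : Hilbert} (x y : H) : hsub x y = hzero -> x = y.
Proof.
  intros E; unfold hsub in E.
  rewrite <- (hadd_zero _ x), <- (hadd_opp _ y), (hadd_comm _ y), hadd_assoc, E.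
  rewrite hadd_comm; apply hadd_zero.
Qed.
Lemma inner_ext {H : Hilbert} (x y : H) : (forall z, inner x z = inner y z) -> x = y.
Proof.
  intros E; apply hsub_eq0, inner_def; rewrite inner_sub_l, E; ring.
Qed.

Lemma hnorm_ge0 {H : Hilbert} (x : H) : 0 <= hnorm x.
Proof. apply sqrt_pos. Qed.
Lemma hnorm_sqr {H : Hilbert} (x : H) : hnorm x * hnorm x = nsq x.
Proof. apply sqrt_sqrt, nsq_ge0. Qed.
Lemma hnorm_zero {H : Hilbert} : hnorm (@hzero H) = 0.
Proof. unfold hnorm; fold (@nsq H hzero); rewrite nsq_zero; apply sqrt_0. Qed.
Lemma hnorm_eq0 {H : Hilbert} (x : H) : hnorm x = 0 -> x = hzero.
Proof. intros E; apply nsq_eq0; rewrite <- hnorm_sqr, E; ring. Qed.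
Lemma hnorm_one {H : Hilbert} (x : H) : inner x x = C1 -> hnorm x = 1.
Proof. intros E; unfold hnorm; rewrite E; apply sqrt_1. Qed.

Lemma nsq_add {H : Hilbert} (x y : H) : nsq (hadd x y) = nsq x + nsq y + 2 * re (inner x y).
Proof.
  unfold nsq; inner_simpl; rewrite (inner_conj_sym _ x y); simpl; ring.
Qed.
Lemma nsq_sub {H : Hilbert} (x y : H) : nsq (hsub x y) = nsq x + nsq y - 2 * re (inner x y).
Proof.
  unfold nsq; inner_simpl; rewrite (inner_conj_sym _ x y); simpl; ring.
Qed.
Lemma nsq_scal {H : Hilbert} a (x : H) : nsq (hscal a x) = Cnorm2 a * nsq x.
Proof.
  unfold nsq; inner_simpl; rewrite inner_self; unfold Cnorm2; simpl; ring.
Qed.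
Lemma hnorm_scal {H : Hilbert} a (x : H) : hnorm (hscal a x) = Cabs a * hnorm x.
Proof.
  unfold hnorm, Cabs; fold (nsq (hscal a x)); fold (nsq x).
  rewrite nsq_scal; apply sqrt_mult; [apply Cnorm2_ge0|apply nsq_ge0].
Qed.
Lemma Cabs_real r : Cabs (mkC r 0) = Rabs r.
Proof.
  unfold Cabs, Cnorm2; simpl; rewrite Rmult_0_r, Rplus_0_r; apply sqrt_Rsqr_abs.
Qed.

(** Positivity of the squared norm of |y|^2 x - <x,y> y, scaled so that no division by |y|^2
    occurs. *)
Lemma cauchy_schwarz_sqr {H : Hilbert} (x y : H) : Cnorm2 (inner x y) <= nsq x * nsq y.
Proof.
  destruct (nsq_ge0 y) as [Hy|Hy].
  - pose proof (nsq_ge0 (hsub (hscal (mkC (nsq y) 0) x) (hscal (inner x y) y))) as K.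
    unfold nsq in K at 1; revert K; inner_simpl.
    rewrite (inner_conj_sym _ x y), !inner_self; unfold Cnorm2 in *; simpl; intros K.
    apply Rmult_le_reg_l with (nsq y); [exact Hy|]. nra.
  - rewrite (nsq_eq0 y) by auto; rewrite inner_zero_r, nsq_zero, Cnorm2_C0; lra.
Qed.
Lemma cauchy_schwarz {H : Hilbert} (x y : H) : Cabs (inner x y) <= hnorm x * hnorm y.
Proof.
  unfold Cabs, hnorm; rewrite <- sqrt_mult by apply inner_pos.
  apply sqrt_le_1_alt, cauchy_schwarz_sqr.
Qed.

Lemma hnorm_add {H : Hilbert} (x y : H) : hnorm (hadd x y) <= hnorm x + hnorm y.
Proof.
  pose proof (hnorm_ge0 x); pose proof (hnorm_ge0 y).
  apply Rsqr_incr_0_var; [|lra]; unfold Rsqr.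
  rewrite hnorm_sqr, nsq_add.
  pose proof (hnorm_sqr x); pose proof (hnorm_sqr y).
  pose proof (cauchy_schwarz x y); pose proof (re_le_Cabs (inner x y)).
  pose proof (RRle_abs (re (inner x y))); nra.
Qed.
Lemma hnorm_opp {H : Hilbert} (x : H) : hnorm (hopp x) = hnorm x.
Proof. unfold hnorm; f_equal; inner_simpl; simpl; ring. Qed.
Lemma hnorm_sub {H : Hilbert} (x y : H) : hnorm (hsub x y) <= hnorm x + hnorm y.
Proof. unfold hsub; rewrite <- (hnorm_opp y); apply hnorm_add. Qed.
Lemma hnorm_sub_sym {H : Hilbert} (x y : H) : hnorm (hsub x y) = hnorm (hsub y x).
Proof.
  rewrite <- hnorm_opp; f_equal; apply inner_ext; intros z; inner_simpl; ring.
Qed.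
Lemma hnorm_sub_trans {H : Hilbert} (x y z : H) :
  hnorm (hsub x z) <= hnorm (hsub x y) + hnorm (hsub y z).
Proof.
  replace (hsub x z) with (hadd (hsub x y) (hsub y z)); [apply hnorm_add|].
  apply inner_ext; intros w; inner_simpl; ring.
Qed.
Lemma nsq_le_hnorm {H : Hilbert} (x y : H) c : 0 <= c ->
  nsq x <= c * c * nsq y -> hnorm x <= c * hnorm y.
Proof.
  intros Hc K; pose proof (hnorm_ge0 x); pose proof (hnorm_ge0 y).
  apply Rsqr_incr_0_var; [|apply Rmult_le_pos; assumption]; unfold Rsqr.
  rewrite hnorm_sqr; pose proof (hnorm_sqr y); nra.
Qed.
Lemma hnorm_le_nsq {H : Hilbert} (x y : H) c :
  hnorm x <= c * hnorm y -> nsq x <= c * c * nsq y.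
Proof.
  intros K; pose proof (hnorm_ge0 x); rewrite <- !hnorm_sqr.
  replace (c * c * (hnorm y * hnorm y)) with ((c * hnorm y) * (c * hnorm y)) by ring.
  apply Rmult_le_compat; assumption.
Qed.

(** * Finite sums and orthogonal systems *)

Fixpoint hsum {H : Hilbert} (n : nat) (f : nat -> H) : H :=
  match n with O => hzero | S n' => hadd (hsum n' f) (f n') end.

Lemma inner_hsum_l {H : Hilbert} n f (y : H) :
  inner (hsum n f) y = csum n (fun i => inner (f i) y).
Proof. induction n; simpl; [apply inner_zero_l|]; rewrite inner_add_l, IHn; reflexivity. Qed.
Lemma inner_hsum_r {H : Hilbert} n f (y : H) :
  inner y (hsum n f) = csum n (fun i => inner y (f i)).
Proof. induction n; simpl; [apply inner_zero_r|]; rewrite inner_add_r, IHn; reflexivity. Qed.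

Lemma linear_zero {H : Hilbert} (T : H -> H) : bounded_linear T -> T hzero = hzero.
Proof.
  intros [_ [HT _]]; replace (@hzero H) with (hscal C0 (@hzero H)) at 1.
  - rewrite HT; apply inner_ext; intros; inner_simpl; ring.
  - apply inner_ext; intros; inner_simpl; ring.
Qed.
Lemma linear_opp {H : Hilbert} (T : H -> H) x : bounded_linear T -> T (hopp x) = hopp (T x).
Proof.
  intros [_ [HT _]]; replace (hopp x) with (hscal (Copp C1) x).
  - rewrite HT; apply inner_ext; intros; inner_simpl; ring.
  - apply inner_ext; intros; inner_simpl; ring.
Qed.
Lemma linear_sub {H : Hilbert} (T : H -> H) x y :
  bounded_linear T -> T (hsub x y) = hsub (T x) (T y).
Proof.
  intros HT; unfold hsub; rewrite (proj1 HT), linear_opp by assumption; reflexivity.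
Qed.
Lemma linear_hsum {H : Hilbert} (T : H -> H) n f :
  bounded_linear T -> T (hsum n f) = hsum n (fun i => T (f i)).
Proof.
  intros HT; induction n; simpl; [apply linear_zero, HT|].
  rewrite (proj1 HT), IHn; reflexivity.
Qed.
Lemma linear_bound {H : Hilbert} (T : H -> H) : bounded_linear T ->
  exists M, 0 < M /\ forall x, hnorm (T x) <= M * hnorm x.
Proof.
  intros [_ [_ [M HM]]]; exists (Rabs M + 1); split; [pose proof (Rabs_pos M); lra|].
  intros x; eapply Rle_trans; [apply HM|].
  apply Rmult_le_compat_r; [apply hnorm_ge0|pose proof (RRle_abs M); lra].
Qed.

(** Zero vectors are allowed, so that greedy constructions that run out of
    directions can still be indexed by all of [nat]. *)
Definition osys {H : Hilbert} (n : nat) (e : nat -> H) : Prop :=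
  (forall i j, (i < n)%nat -> (j < n)%nat -> i <> j -> inner (e i) (e j) = C0) /\
  (forall i, (i < n)%nat -> inner (e i) (e i) = C1 \/ e i = hzero).
Definition perp {H : Hilbert} (n : nat) (e : nat -> H) (x : H) : Prop :=
  forall j, (j < n)%nat -> inner x (e j) = C0.
Definition proj {H : Hilbert} (n : nat) (e : nat -> H) (x : H) : H :=
  hsum n (fun j => hscal (inner x (e j)) (e j)).
Definition resid {H : Hilbert} (n : nat) (e : nat -> H) (x : H) : H := hsub x (proj n e x).
Definition orthonormal {H : Hilbert} (n : nat) (e : nat -> H) : Prop :=
  forall i j, (i < n)%nat -> (j < n)%nat ->
    inner (e i) (e j) = if Nat.eq_dec i j then C1 else C0.

Lemma orthonormal_osys {H : Hilbert} n (e : nat -> H) : orthonormal n e -> osys n e.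
Proof.
  intros He; split.
  - intros i j Hi Hj Hij; rewrite He by assumption; destruct (Nat.eq_dec i j); congruence.
  - intros i Hi; left; rewrite He by assumption; destruct (Nat.eq_dec i i); congruence.
Qed.
Lemma osys_orthonormal {H : Hilbert} n (e : nat -> H) : osys n e ->
  (forall i, (i < n)%nat -> e i <> hzero) -> orthonormal n e.
Proof.
  intros [He1 He2] Hnz i j Hi Hj; destruct (Nat.eq_dec i j) as [<-|Hij]; [|auto].
  destruct (He2 i Hi); [assumption|exfalso; eapply Hnz; eauto].
Qed.
Lemma osys_S {H : Hilbert} n (e : nat -> H) : osys n e -> perp n e (e n) ->
  (inner (e n) (e n) = C1 \/ e n = hzero) -> osys (S n) e.
Proof.
  intros [He1 He2] Hp Hn; split.
  - intros i j Hi Hj Hij.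
    destruct (Nat.eq_dec i n) as [->|Hin]; destruct (Nat.eq_dec j n) as [->|Hjn]; try lia.
    + apply Hp; lia.
    + rewrite inner_conj_sym, Hp by lia; apply Cconj_C0.
    + apply He1; lia.
  - intros i Hi; destruct (Nat.eq_dec i n) as [->|]; [exact Hn|apply He2; lia].
Qed.
Lemma perp_le {H : Hilbert} n m (e : nat -> H) x : (n <= m)%nat -> perp m e x -> perp n e x.
Proof. intros Hn Hp j Hj; apply Hp; lia. Qed.
Lemma perp_osys {H : Hilbert} n m k (e : nat -> H) : osys m e ->
  (n <= k < m)%nat -> perp n e (e k).
Proof. intros [He _] Hk j Hj; apply He; lia. Qed.

Lemma osys_hnorm_le1 {H : Hilbert} n (e : nat -> H) i : osys n e -> (i < n)%nat ->
  hnorm (e i) <= 1.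
Proof.
  intros [_ He] Hi; destruct (He i Hi) as [E|E].
  - rewrite hnorm_one by exact E; lra.
  - rewrite E, hnorm_zero; lra.
Qed.

Lemma inner_proj_self {H : Hilbert} n (e : nat -> H) x k : osys n e -> (k < n)%nat ->
  inner (proj n e x) (e k) = inner x (e k).
Proof.
  intros [He1 He2] Hk; unfold proj; rewrite inner_hsum_l.
  rewrite (csum_single n k); [|exact Hk|].
  - rewrite inner_scal_l; destruct (He2 k Hk) as [->| ->]; [ring|].
    rewrite inner_zero_r; ring.
  - intros i Hi Hik; rewrite inner_scal_l, He1 by assumption; ring.
Qed.
Lemma resid_perp {H : Hilbert} n (e : nat -> H) x : osys n e -> perp n e (resid n e x).
Proof.
  intros He k Hk; unfold resid; rewrite inner_sub_l, inner_proj_self by assumption; ring.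
Qed.
Lemma inner_proj_l {H : Hilbert} n (e : nat -> H) x y :
  inner (proj n e x) y = csum n (fun i => Cmul (inner x (e i)) (inner (e i) y)).
Proof.
  unfold proj; rewrite inner_hsum_l; apply csum_ext; intros; apply inner_scal_l.
Qed.
Lemma perp_proj {H : Hilbert} n (e : nat -> H) x y : perp n e y -> inner (proj n e x) y = C0.
Proof.
  intros Hy; rewrite inner_proj_l; apply csum_0; intros i Hi.
  rewrite (inner_conj_sym _ y (e i)), Hy by assumption; rewrite Cconj_C0; ring.
Qed.
Lemma nsq_proj {H : Hilbert} n (e : nat -> H) x : osys n e ->
  nsq (proj n e x) = rsum n (fun i => Cnorm2 (inner x (e i))).
Proof.
  intros He; unfold nsq; rewrite inner_proj_l, csum_re; apply rsum_ext; intros i Hi.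
  rewrite (inner_conj_sym _ (proj n e x)), inner_proj_self, Cmul_conj by assumption; reflexivity.
Qed.
Lemma proj_resid {H : Hilbert} n (e : nat -> H) x : hadd (proj n e x) (resid n e x) = x.
Proof. apply inner_ext; intros z; unfold resid; inner_simpl; ring. Qed.
Lemma pythagoras {H : Hilbert} n (e : nat -> H) x : osys n e ->
  nsq x = rsum n (fun i => Cnorm2 (inner x (e i))) + nsq (resid n e x).
Proof.
  intros He; rewrite <- (proj_resid n e x) at 1; rewrite nsq_add, nsq_proj by assumption.
  rewrite perp_proj by (apply resid_perp; assumption); simpl; ring.
Qed.
Lemma bessel {H : Hilbert} n (e : nat -> H) x : osys n e ->
  rsum n (fun i => Cnorm2 (inner x (e i))) <= nsq x.
Proof. intros He; rewrite (pythagoras n e x He); pose proof (nsq_ge0 (resid n e x)); lra. Qed.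
Lemma nsq_resid_le {H : Hilbert} n (e : nat -> H) x : osys n e -> nsq (resid n e x) <= nsq x.
Proof.
  intros He; rewrite (pythagoras n e x He).
  assert (0 <= rsum n (fun i => Cnorm2 (inner x (e i))))
    by (apply rsum_ge0; intros; apply Cnorm2_ge0); lra.
Qed.
Lemma hnorm_resid_le {H : Hilbert} n (e : nat -> H) x : osys n e ->
  hnorm (resid n e x) <= hnorm x.
Proof. intros He; apply sqrt_le_1_alt; apply nsq_resid_le, He. Qed.

Lemma normalize {H : Hilbert} (x : H) : x <> hzero ->
  exists a, inner (hscal a x) (hscal a x) = C1 /\ a = mkC (/ hnorm x) 0.
Proof.
  intros Hx; exists (mkC (/ hnorm x) 0); split; [|reflexivity].
  assert (hnorm x <> 0) by (intros E; apply Hx, hnorm_eq0, E).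
  rewrite inner_self, nsq_scal, <- hnorm_sqr; apply Cplx_ext; unfold Cnorm2; simpl; [|ring].
  field; assumption.
Qed.

(** Recursive choice where step n sees all earlier choices. The argument [f] stands for a prefix of
    length n, and the first hypothesis says that [R n] looks at nothing beyond it. *)
Lemma greedy {A : Type} (a0 : A) (R : nat -> (nat -> A) -> A -> Prop) :
  (forall n f g v, (forall i, (i < n)%nat -> f i = g i) -> R n f v -> R n g v) ->
  (forall n f, exists v, R n f v) ->
  exists e : nat -> A, forall n, R n e (e n).
Proof.
  intros Hext Hex.
  pose (next := fun n f => proj1_sig (constructive_indefinite_description _ (Hex n f))).
  assert (Hnext : forall n f, R n f (next n f)).
  { intros n f; unfold next; destruct constructive_indefinite_description; assumption. }
  (* [st n] is the table after n choices, filled with [a0] from index n on; later stages never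
     change an entry already chosen. *)
  pose (st := fix st n : nat -> A := match n with
    | O => fun _ => a0
    | S m => fun i => if Nat.eq_dec i m then next m (st m) else st m i end).
  exists (fun n => st (S n) n).
  assert (Hst : forall n i, (i < n)%nat -> st n i = st (S i) i).
  { induction n; intros i Hi; [lia|].
    destruct (Nat.eq_dec i n) as [->|Hne]; [reflexivity|].
    transitivity (st n i); [|apply IHn; lia].
    simpl; destruct (Nat.eq_dec i n); [contradiction|reflexivity]. }
  intros n; apply Hext with (st n); [apply Hst|].
  simpl; destruct (Nat.eq_dec n n); [apply Hnext|congruence].
Qed.

(** * Limits *)

Lemma Un_cv_squeeze (a b : nat -> R) l :
  (forall n, Rabs (a n - l) <= b n) -> Un_cv b 0 -> Un_cv a l.
Proof.
  intros Hab Hb eps Heps; destruct (Hb eps Heps) as [N HN]; exists N; intros n Hn.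
  specialize (HN n Hn); unfold Rdist in *; rewrite Rminus_0_r in HN.
  eapply Rle_lt_trans; [apply Hab|]; eapply Rle_lt_trans; [apply RRle_abs|exact HN].
Qed.
Lemma Un_cv_const c : Un_cv (fun _ => c) c.
Proof.
  intros eps Heps; exists 0%nat; intros; unfold Rdist; rewrite Rminus_diag, Rabs_R0; exact Heps.
Qed.
Lemma Un_cv_le (a : nat -> R) l c : (forall n, a n <= c) -> Un_cv a l -> l <= c.
Proof. intros Ha Hl; exact (Rle_cv_lim Ha Hl (Un_cv_const c)). Qed.
Lemma Un_cv_ge (a : nat -> R) l c : (forall n, c <= a n) -> Un_cv a l -> c <= l.
Proof. intros Ha Hl; exact (Rle_cv_lim Ha (Un_cv_const c) Hl). Qed.

Definition Ccv (a : nat -> Cplx) (l : Cplx) : Prop :=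
  Un_cv (fun n => re (a n)) (re l) /\ Un_cv (fun n => im (a n)) (im l).

Lemma Ccv_unique a l k : Ccv a l -> Ccv a k -> l = k.
Proof. intros [? ?] [? ?]; apply Cplx_ext; eapply UL_sequence; eauto. Qed.
Lemma Un_cv_ext (a b : nat -> R) l : (forall n, a n = b n) -> Un_cv a l -> Un_cv b l.
Proof.
  intros E Ha eps Heps; destruct (Ha eps Heps) as [N HN]; exists N; intros n Hn.
  rewrite <- E; auto.
Qed.
Lemma Ccv_ext a b l : (forall n, a n = b n) -> Ccv a l -> Ccv b l.
Proof.
  intros E [Hr Hi]; split; eapply Un_cv_ext; try eassumption; intros; simpl; rewrite E; reflexivity.
Qed.
Lemma Ccv_add a b l k : Ccv a l -> Ccv b k -> Ccv (fun n => Cadd (a n) (b n)) (Cadd l k).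
Proof. intros [? ?] [? ?]; split; simpl; apply CV_plus; assumption. Qed.
Lemma Ccv_const c : Ccv (fun _ => c) c.
Proof. split; apply Un_cv_const. Qed.
Lemma Ccv_mul c a l : Ccv a l -> Ccv (fun n => Cmul c (a n)) (Cmul c l).
Proof.
  intros [? ?]; split; simpl.
  - apply CV_minus; apply CV_mult; auto using Un_cv_const.
  - apply CV_plus; apply CV_mult; auto using Un_cv_const.
Qed.
Lemma Ccv_squeeze a l b : (forall n, Cabs (Csub (a n) l) <= b n) -> Un_cv b 0 -> Ccv a l.
Proof.
  intros Hab Hb; split; apply Un_cv_squeeze with b; auto; intros n;
    (eapply Rle_trans; [|apply Hab]).
  - apply (re_le_Cabs (Csub (a n) l)).
  - apply (im_le_Cabs (Csub (a n) l)).
Qed.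

Lemma converges_hnorm {H : Hilbert} (u : nat -> H) l :
  converges u l <-> Un_cv (fun n => hnorm (hsub (u n) l)) 0.
Proof.
  split; intros Hu eps Heps; destruct (Hu eps Heps) as [N HN]; exists N; intros n Hn;
    specialize (HN n Hn); unfold Rdist in *; rewrite Rminus_0_r, Rabs_pos_eq in *;
    auto; apply hnorm_ge0.
Qed.
Lemma converges_const {H : Hilbert} (x : H) : converges (fun _ => x) x.
Proof.
  intros eps Heps; exists 0%nat; intros; replace (hsub x x) with (@hzero H);
    [rewrite hnorm_zero; exact Heps|].
  apply inner_ext; intros; inner_simpl; ring.
Qed.
Lemma converges_inner {H : Hilbert} (u v : nat -> H) l k : converges u l -> converges v k ->
  Ccv (fun n => inner (u n) (v n)) (inner l k).
Proof.
  rewrite !converges_hnorm; intros Hu Hv.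
  set (a := fun n => hnorm (hsub (u n) l)) in *; set (b := fun n => hnorm (hsub (v n) k)) in *.
  apply Ccv_squeeze with (fun n => a n * b n + a n * hnorm k + hnorm l * b n).
  - intros n; replace (Csub (inner (u n) (v n)) (inner l k)) with
      (Cadd (Cadd (inner (hsub (u n) l) (hsub (v n) k)) (inner (hsub (u n) l) k))
        (inner l (hsub (v n) k))) by (inner_simpl; ring).
    eapply Rle_trans; [apply Cabs_add|]; apply Rplus_le_compat; [|apply cauchy_schwarz].
    eapply Rle_trans; [apply Cabs_add|]; apply Rplus_le_compat; apply cauchy_schwarz.
  - replace 0 with (0 * 0 + 0 * hnorm k + hnorm l * 0) by ring.
    repeat apply CV_plus; apply CV_mult; auto using Un_cv_const.
Qed.
Lemma converges_nsq {H : Hilbert} (u : nat -> H) l :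
  converges u l -> Un_cv (fun n => nsq (u n)) (nsq l).
Proof. intros Hu; exact (proj1 (converges_inner u u l l Hu Hu)). Qed.
Lemma converges_linear {H : Hilbert} (T : H -> H) (u : nat -> H) l :
  bounded_linear T -> converges u l -> converges (fun n => T (u n)) (T l).
Proof.
  intros HT; destruct (linear_bound T HT) as [M [HM HTM]].
  intros Hu eps Heps; destruct (Hu (eps / M)) as [N HN]; [apply Rdiv_lt_0_compat; lra|].
  exists N; intros n Hn; rewrite <- linear_sub by assumption.
  eapply Rle_lt_trans; [apply HTM|]; specialize (HN n Hn).
  apply Rmult_lt_compat_l with (r := M) in HN; [|lra].
  replace (M * (eps / M)) with eps in HN by (field; lra); exact HN.
Qed.
Lemma cauchy_converges {H : Hilbert} (u : nat -> H) :
  (forall eps, 0 < eps -> exists N, forall m n, (N <= m)%nat -> (N <= n)%nat ->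
     hnorm (hsub (u m) (u n)) < eps) -> exists l, converges u l.
Proof. exact (hcomplete H u). Qed.
Lemma converges_cauchy {H : Hilbert} (u : nat -> H) l : converges u l ->
  forall eps, 0 < eps -> exists N, forall m n, (N <= m)%nat -> (N <= n)%nat ->
     hnorm (hsub (u m) (u n)) < eps.
Proof.
  intros Hu eps Heps; destruct (Hu (eps / 2)) as [N HN]; [lra|]; exists N; intros m n Hm Hn.
  pose proof (HN m Hm); pose proof (HN n Hn).
  eapply Rle_lt_trans; [apply (hnorm_sub_trans _ l)|]; rewrite (hnorm_sub_sym l); lra.
Qed.
Lemma inv_INR_lt eps : 0 < eps -> exists N, forall n, (N <= n)%nat -> / (INR n + 1) < eps.
Proof.
  intros Heps; destruct (archimed_cor1 eps Heps) as [N [HN HN0]]; exists N; intros n Hn.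
  eapply Rle_lt_trans; [|exact HN]; apply Rinv_le_contravar; [apply lt_0_INR, HN0|].
  apply le_INR in Hn; lra.
Qed.
Lemma INR1_pos n : 0 < INR n + 1.
Proof. pose proof (pos_INR n); lra. Qed.

(** Convergence of orthogonal series: squared distances are increments of a bounded monotone real
    sequence, so the partial sums are Cauchy. It serves both Parseval and the construction of
    |T|. *)
Lemma converges_of_increments {H : Hilbert} (v : nat -> H) (s : nat -> R) B :
  (forall m n, (m <= n)%nat -> nsq (hsub (v n) (v m)) = s n - s m) -> (forall n, s n <= B) ->
  exists l, converges v l.
Proof.
  intros Hdiff HB.
  assert (Hgrow : Un_growing s).
  { intros n; pose proof (Hdiff n (S n) ltac:(lia)) as E.
    pose proof (nsq_ge0 (hsub (v (S n)) (v n))); lra. }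
  destruct (growing_cv s Hgrow) as [l Hl]; [exists B; intros r [n ->]; apply HB|].
  apply cauchy_converges; intros eps Heps.
  destruct (CV_Cauchy s (exist _ l Hl) (eps * eps)) as [N HN]; [nra|].
  assert (K : forall m n, (N <= m)%nat -> (m <= n)%nat -> hnorm (hsub (v n) (v m)) < eps).
  { intros m n Hm Hn; specialize (HN n m ltac:(lia) ltac:(lia)); unfold Rdist in HN.
    rewrite <- (Hdiff m n Hn), <- hnorm_sqr, Rabs_pos_eq in HN by apply Rle_0_sqr.
    pose proof (hnorm_ge0 (hsub (v n) (v m))); nra. }
  exists N; intros m n Hm Hn; destruct (Nat.le_gt_cases m n).
  - rewrite hnorm_sub_sym; auto.
  - apply K; lia.
Qed.

(** * Subsequences and compactness *)

Definition increasing (phi : nat -> nat) : Prop := forall n, (phi n < phi (S n))%nat.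

Lemma increasing_lt phi : increasing phi -> forall m n, (m < n)%nat -> (phi m < phi n)%nat.
Proof.
  intros Hp m n Hmn; induction Hmn as [|n Hmn IH]; [apply Hp|]; pose proof (Hp n); lia.
Qed.
Lemma increasing_ge phi : increasing phi -> forall n, (n <= phi n)%nat.
Proof. intros Hp; induction n; [lia|]; pose proof (Hp n); lia. Qed.
Lemma increasing_comp phi psi : increasing phi -> increasing psi ->
  increasing (fun n => phi (psi n)).
Proof. intros Hp Hq n; apply increasing_lt; auto. Qed.

Lemma bounded_subseq (a : nat -> R) M : (forall n, Rabs (a n) <= M) ->
  exists psi, increasing psi /\ exists l, Un_cv (fun n => a (psi n)) l.
Proof.
  intros Ha.
  destruct (Bolzano_Weierstrass a (fun c => - M <= c <= M)) as [l Hl].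
  - apply compact_P3.
  - intros n; specialize (Ha n); unfold Rabs in Ha; destruct (Rcase_abs (a n)); lra.
  (* Bolzano-Weierstrass supplies a cluster value only; the increasing indices are extracted from it
     greedily, the n-th within 1/(n+1). *)
  - assert (Hpick : forall N k, exists q, (N <= q)%nat /\ Rabs (a q - l) < / (INR k + 1)).
    { intros N k.
      assert (Hk : 0 < / (INR k + 1)) by apply Rinv_0_lt_compat, INR1_pos.
      destruct (Hl (disc l (mkposreal _ Hk)) N) as [q [Hq Hd]].
      - exists (mkposreal _ Hk); intros x Hx; exact Hx.
      - exists q; split; assumption. }
    destruct (greedy 0%nat (fun n f v => (forall k, (k < n)%nat -> (f k < v)%nat) /\
      Rabs (a v - l) < / (INR n + 1))) as [psi Hpsi].
    + intros n f g v Hfg [Hn Hv]; split; auto; intros k Hk; rewrite <- Hfg; auto.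
    + intros n f.
      assert (HN : exists N, forall k, (k < n)%nat -> (f k < N)%nat).
      { clear; induction n as [|n [N HN]]; [exists 0%nat; lia|].
        exists (N + S (f n))%nat; intros k Hk; destruct (Nat.eq_dec k n) as [->|]; [lia|].
        specialize (HN k); lia. }
      destruct HN as [N HN]; destruct (Hpick N n) as [q [Hq Hq']].
      exists q; split; [|exact Hq']; intros k Hk; specialize (HN k Hk); lia.
    + exists psi; split; [intros n; apply (proj1 (Hpsi (S n))); lia|].
      exists l; intros eps Heps; destruct (inv_INR_lt eps Heps) as [N HN].
      exists N; intros n Hn; unfold Rdist; specialize (HN n Hn).
      pose proof (proj2 (Hpsi n)); lra.
Qed.

(** Cantor's diagonal argument: [Phi (S j)] refines [Phi j] so that row j converges, and the
    diagonal is eventually a subsequence of each [Phi (S j)]. *)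
Lemma diagonal_subseq (a : nat -> nat -> R) (M : nat -> R) :
  (forall j n, Rabs (a j n) <= M j) ->
  exists phi, increasing phi /\ forall j, exists l, Un_cv (fun n => a j (phi n)) l.
Proof.
  intros Ha.
  assert (Hex : forall j (phi : nat -> nat), exists psi,
    increasing psi /\ exists l, Un_cv (fun n => a j (phi (psi n))) l).
  { intros j phi; apply (bounded_subseq (fun n => a j (phi n)) (M j)); auto. }
  pose (ext := fun j phi => proj1_sig (constructive_indefinite_description _ (Hex j phi))).
  assert (Hext : forall j phi, increasing (ext j phi) /\
    exists l, Un_cv (fun n => a j (phi (ext j phi n))) l).
  { intros j phi; unfold ext; destruct constructive_indefinite_description; assumption. }
  pose (Phi := fix Phi j : nat -> nat := match j with
    | O => fun n => n | S k => fun n => Phi k (ext k (Phi k) n) end).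
  assert (HPhi : forall j, increasing (Phi j)).
  { induction j; [intros n; simpl; lia|].
    apply (increasing_comp (Phi j) (ext j (Phi j))); [assumption|apply Hext]. }
  exists (fun n => Phi n n); split.
  - intros n; simpl; apply increasing_lt; [apply HPhi|].
    pose proof (increasing_ge _ (proj1 (Hext n (Phi n))) (S n)); lia.
  - intros j; destruct (proj2 (Hext j (Phi j))) as [l Hl]; exists l.
    assert (Hsub : forall i n, exists k, (n <= k)%nat /\ Phi (i + S j)%nat n = Phi (S j) k).
    { induction i as [|i IH]; intros n; [exists n; split; [lia|reflexivity]|].
      destruct (IH (ext (i + S j)%nat (Phi (i + S j)%nat) n)) as [k [Hk E]].
      exists k; split; [|exact E].
      pose proof (increasing_ge _ (proj1 (Hext (i + S j)%nat (Phi (i + S j)%nat))) n); lia. }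
    intros eps Heps; destruct (Hl eps Heps) as [N HN]; exists (N + S j)%nat; intros n Hn.
    destruct (Hsub (n - S j)%nat n) as [k [Hk E]].
    replace (n - S j + S j)%nat with n in E by lia; rewrite E.
    apply (HN k); lia.
Qed.

(** Weak convergence in Cauchy form, without naming a limit vector. Testing against i y recovers the
    imaginary parts. *)
Definition weak_cauchy {H : Hilbert} (v : nat -> H) : Prop :=
  forall y eps, 0 < eps -> exists N, forall m n, (N <= m)%nat -> (N <= n)%nat ->
    Rabs (re (inner (hsub (v m) (v n)) y)) < eps.

Lemma weak_cauchy_subseq {H : Hilbert} (v : nat -> H) phi :
  weak_cauchy v -> increasing phi -> weak_cauchy (fun n => v (phi n)).
Proof.
  intros Hv Hp y eps Heps; destruct (Hv y eps Heps) as [N HN]; exists N; intros m n Hm Hn.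
  pose proof (increasing_ge phi Hp m); pose proof (increasing_ge phi Hp n).
  apply HN; lia.
Qed.

(** Weak sequential compactness of balls: a diagonal sequence handles a countable dense set, and
    boundedness carries this over to every y. *)
Lemma bounded_weak_subseq {H : Hilbert} (u : nat -> H) M : (forall n, hnorm (u n) <= M) ->
  exists phi, increasing phi /\ weak_cauchy (fun n => u (phi n)).
Proof.
  intros Hu; destruct (hseparable H) as [d Hd].
  destruct (diagonal_subseq (fun j n => re (inner (u n) (d j))) (fun j => M * hnorm (d j)))
    as [phi [Hphi Hcv]].
  { intros j n; eapply Rle_trans; [apply re_le_Cabs|].
    eapply Rle_trans; [apply cauchy_schwarz|].
    apply Rmult_le_compat_r; [apply hnorm_ge0|apply Hu]. }
  exists phi; split; [exact Hphi|]; intros y eps Heps.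
  assert (HM : 0 <= M) by exact (Rle_trans _ _ _ (hnorm_ge0 (u 0%nat)) (Hu 0%nat)).
  (* Two members of the sequence differ by at most 2M, so replacing y by [d j] costs at most eps/2.
     The [+ 1] keeps the denominator positive. *)
  destruct (Hd y (eps / (4 * (M + 1)))) as [j Hj]; [apply Rdiv_lt_0_compat; lra|].
  change (hnorm (hsub y (d j)) < eps / (4 * (M + 1))) in Hj.
  destruct (Hcv j) as [l Hl]; destruct (Hl (eps / 4)) as [N HN]; [lra|].
  exists N; intros m n Hm Hn.
  pose proof (HN m Hm) as Km; pose proof (HN n Hn) as Kn; unfold Rdist in Km, Kn.
  assert (Hdiff : hnorm (hsub (u (phi m)) (u (phi n))) <= 2 * M).
  { eapply Rle_trans; [apply hnorm_sub|].
    pose proof (Hu (phi m)); pose proof (Hu (phi n)); lra. }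
  assert (K : Rabs (re (inner (hsub (u (phi m)) (u (phi n))) (hsub y (d j)))) <= eps / 2).
  { eapply Rle_trans; [apply re_le_Cabs|]; eapply Rle_trans; [apply cauchy_schwarz|].
    apply Rle_trans with (2 * M * (eps / (4 * (M + 1)))).
    - apply Rmult_le_compat; auto using hnorm_ge0; lra.
    - apply Rmult_le_reg_r with (4 * (M + 1)); [lra|].
      replace (2 * M * (eps / (4 * (M + 1))) * (4 * (M + 1))) with (2 * M * eps) by (field; lra).
      nra. }
  revert K; rewrite inner_sub_r; set (z := inner _ y); simpl; intros K.
  assert (E : re (inner (hsub (u (phi m)) (u (phi n))) (d j)) =
    re (inner (u (phi m)) (d j)) - re (inner (u (phi n)) (d j)))
    by (rewrite inner_sub_l; reflexivity).
  rewrite E in K; clear -K Km Kn Heps.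
  apply Rabs_def2 in Km; apply Rabs_def2 in Kn.
  apply Rabs_def1; unfold Rabs in K; destruct Rcase_abs in K; lra.
Qed.

Lemma weak_cauchy_Cnorm2 {H : Hilbert} (v : nat -> H) k (e : nat -> H) eps :
  weak_cauchy v -> 0 < eps -> exists N, forall m n, (N <= m)%nat -> (N <= n)%nat ->
    rsum k (fun j => Cnorm2 (inner (hsub (v m) (v n)) (e j))) < eps.
Proof.
  intros Hv; revert eps; induction k; intros eps Heps; [exists 0%nat; intros; simpl; lra|].
  destruct (IHk (eps / 2)) as [N HN]; [lra|].
  (* Since t <= 1, t^2 <= t <= eps/4; the real and imaginary parts of the new coefficient, each
     below t, add less than eps/2. *)
  pose (t := Rmin 1 (eps / 4)).
  assert (Ht : 0 < t) by (apply Rmin_glb_lt; lra).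
  assert (Ht1 : t <= 1) by apply Rmin_l.
  assert (Ht2 : t <= eps / 4) by apply Rmin_r.
  destruct (Hv (e k) t Ht) as [N1 HN1].
  destruct (Hv (hscal (mkC 0 1) (e k)) t Ht) as [N2 HN2].
  exists (N + N1 + N2)%nat; intros m n Hm Hn; simpl.
  specialize (HN m n ltac:(lia) ltac:(lia)).
  specialize (HN1 m n ltac:(lia) ltac:(lia)).
  specialize (HN2 m n ltac:(lia) ltac:(lia)).
  rewrite inner_scal_r in HN2; set (z := inner _ (e k)) in *.
  simpl in HN2; replace (0 * re z - - (1) * im z) with (im z) in HN2 by ring.
  apply Rabs_def2 in HN1 as [? ?]; apply Rabs_def2 in HN2 as [? ?].
  assert (t * t <= t) by nra.
  assert (re z * re z < t * t) by nra.
  assert (im z * im z < t * t) by nra.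
  assert (Cnorm2 z = re z * re z + im z * im z) by reflexivity; lra.
Qed.

(** With P the projection on the span of e_0, ..., e_(n-1) and Q = 1 - P, write T = PT + QTP + QTQ.
    The first two terms see finitely many coordinates of Tv and v, where weakly Cauchy means norm
    Cauchy; the last is small by hypothesis. *)
Lemma compact_of_finite_rank_approx {H : Hilbert} (T : H -> H) : bounded_linear T ->
  (forall eps, 0 < eps -> exists n e, osys n e /\
     forall x, perp n e x -> hnorm (resid n e (T x)) <= eps * hnorm x) ->
  compact_op T.
Proof.
  intros HT Happ u [M HM].
  destruct (linear_bound T HT) as [L [HL HTL]].
  destruct (bounded_weak_subseq u M HM) as [phi [Hphi Hw]].
  (* A second extraction makes the images weakly Cauchy too, in place of moving T across the inner
     product. *)
  destruct (bounded_weak_subseq (fun n => T (u (phi n))) (L * M)) as [psi [Hpsi Hw']].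
  { intros n; eapply Rle_trans; [apply HTL|]; apply Rmult_le_compat_l; [lra|apply HM]. }
  apply (weak_cauchy_subseq _ psi) in Hw; [|exact Hpsi].
  exists (fun n => phi (psi n)); split; [apply increasing_comp; assumption|].
  apply cauchy_converges; intros eps Heps.
  assert (HM0 : 0 <= M) by exact (Rle_trans _ _ _ (hnorm_ge0 (u 0%nat)) (HM 0%nat)).
  (* Differences have norm at most 2M, so the QTQ term is at most eps/4. Below, eps/(4L) does the
     same for QTP, as T expands norms by at most L. *)
  destruct (Happ (eps / (8 * (M + 1)))) as [k [e [He Hres]]]; [apply Rdiv_lt_0_compat; lra|].
  set (v := fun n => u (phi (psi n))) in *.
  change (weak_cauchy (fun n => T (v n))) in Hw'.
  assert (H4 : 0 < eps / 4) by lra.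
  assert (H4L : 0 < eps / (4 * L)) by (apply Rdiv_lt_0_compat; lra).
  destruct (weak_cauchy_Cnorm2 _ k e (eps / 4 * (eps / 4)) Hw') as [N1 HN1]; [nra|].
  destruct (weak_cauchy_Cnorm2 _ k e (eps / (4 * L) * (eps / (4 * L))) Hw) as [N2 HN2];
    [apply Rmult_lt_0_compat; assumption|].
  exists (N1 + N2)%nat; intros m n Hm Hn.
  specialize (HN1 m n ltac:(lia) ltac:(lia)).
  specialize (HN2 m n ltac:(lia) ltac:(lia)).
  change (hnorm (hsub (T (v m)) (T (v n))) < eps).
  rewrite <- linear_sub in * by assumption.
  set (d := hsub (v m) (v n)) in *.
  assert (Hd : hnorm d <= 2 * M).
  { eapply Rle_trans; [apply hnorm_sub|].
    pose proof (HM (phi (psi m))); pose proof (HM (phi (psi n))); unfold v; lra. }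
  assert (sqlt : forall (x : H) c, 0 < c -> nsq x < c * c -> hnorm x < c).
  { intros x c Hc Hx; rewrite <- hnorm_sqr in Hx; pose proof (hnorm_ge0 x); nra. }
  rewrite <- nsq_proj in HN1, HN2 by assumption.
  apply sqlt in HN1; [|assumption]; apply sqlt in HN2; [|assumption].
  assert (HTP : hnorm (resid k e (T (proj k e d))) <= eps / 4).
  { eapply Rle_trans; [apply hnorm_resid_le, He|]; eapply Rle_trans; [apply HTL|].
    replace (eps / 4) with (L * (eps / (4 * L))) by (field; lra).
    apply Rmult_le_compat_l; lra. }
  assert (HTQ : hnorm (resid k e (T (resid k e d))) <= eps / 4).
  { eapply Rle_trans; [apply Hres, resid_perp, He|].
    apply Rle_trans with (eps / (8 * (M + 1)) * (2 * M)).
    - apply Rmult_le_compat_l; [left; apply Rdiv_lt_0_compat; lra|].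
      eapply Rle_trans; [apply hnorm_resid_le, He|exact Hd].
    - apply Rmult_le_reg_r with (8 * (M + 1)); [lra|].
      replace (eps / (8 * (M + 1)) * (2 * M) * (8 * (M + 1))) with (2 * M * eps)
        by (field; lra). nra. }
  replace (T d) with (hadd (proj k e (T d))
    (hadd (resid k e (T (proj k e d))) (resid k e (T (resid k e d))))).
  - eapply Rle_lt_trans; [apply hnorm_add|].
    assert (hnorm (hadd (resid k e (T (proj k e d))) (resid k e (T (resid k e d)))) <= eps / 2)
      by (eapply Rle_trans; [apply hnorm_add|lra]).
    lra.
  - rewrite <- (proj_resid k e (T d)) at 2; f_equal.
    apply inner_ext; intros z; rewrite <- (proj_resid k e d) at 3; rewrite (proj1 HT).
    unfold resid at 1 2 4; inner_simpl; rewrite !inner_proj_l.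
    rewrite (csum_ext k (fun i => Cmul (inner (hadd _ _) (e i)) _)
      (fun i => Cadd (Cmul (inner (T (proj k e d)) (e i)) (inner (e i) z))
        (Cmul (inner (T (resid k e d)) (e i)) (inner (e i) z))))
      by (intros; rewrite inner_add_l; ring).
    rewrite csum_add; ring.
Qed.

(** * Singular vectors of a compact operator *)

Lemma perp_zero {H : Hilbert} n (e : nat -> H) : perp n e hzero.
Proof. intros j _; apply inner_zero_l. Qed.
Lemma perp_scal {H : Hilbert} n (e : nat -> H) a x : perp n e x -> perp n e (hscal a x).
Proof. intros Hx j Hj; rewrite inner_scal_l, Hx by assumption; ring. Qed.
Lemma perp_add {H : Hilbert} n (e : nat -> H) x y :
  perp n e x -> perp n e y -> perp n e (hadd x y).
Proof. intros Hx Hy j Hj; rewrite inner_add_l, Hx, Hy by assumption; ring. Qed.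
Lemma perp_ext {H : Hilbert} n (e f : nat -> H) x : (forall i, (i < n)%nat -> e i = f i) ->
  perp n e x -> perp n f x.
Proof. intros E Hx j Hj; rewrite <- E by assumption; auto. Qed.
Lemma perp_limit {H : Hilbert} n (e : nat -> H) (u : nat -> H) l :
  (forall k, perp n e (u k)) -> converges u l -> perp n e l.
Proof.
  intros Hu Hl j Hj.
  apply (Ccv_unique (fun k => inner (u k) (e j))).
  - apply (converges_inner u (fun _ => e j)); [exact Hl|apply converges_const].
  - apply Ccv_ext with (fun _ => C0); [|apply Ccv_const]; intros; symmetry; apply Hu, Hj.
Qed.

Lemma bound_of_unit_bound {H : Hilbert} (T : H -> H) n (e : nat -> H) M : bounded_linear T ->
  (forall x, perp n e x -> hnorm x <= 1 -> hnorm (T x) <= M) ->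
  forall x, perp n e x -> hnorm (T x) <= M * hnorm x.
Proof.
  intros HT HM x Hx; destruct (classic (x = hzero)) as [->|Hnz].
  - rewrite linear_zero, hnorm_zero by assumption; lra.
  - destruct (normalize x Hnz) as [a [Ha Ea]].
    pose proof (HM (hscal a x) (perp_scal n e a x Hx)) as K.
    rewrite (hnorm_one _ Ha) in K; specialize (K (Rle_refl 1)).
    rewrite (proj1 (proj2 HT)), hnorm_scal, Ea, Cabs_real in K.
    assert (Hpos : 0 < hnorm x).
    { destruct (hnorm_ge0 x) as [|E]; [assumption|exfalso; apply Hnz, hnorm_eq0; auto]. }
    rewrite Rabs_pos_eq in K by (left; apply Rinv_0_lt_compat, Hpos).
    apply Rmult_le_compat_l with (r := hnorm x) in K; [|lra].
    rewrite <- Rmult_assoc, Rinv_r in K by lra; lra.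
Qed.

(* A maximizing sequence is Cauchy: once [T x_k] is nearly constant, [x_j + x_k] is
   nearly as long as it can be, so the parallelogram law makes [x_j - x_k] short. *)
Lemma compact_maximizer {H : Hilbert} (T : H -> H) n (e : nat -> H) :
  bounded_linear T -> compact_op T ->
  exists v, perp n e v /\ (inner v v = C1 \/ v = hzero) /\
    forall x, perp n e x -> hnorm (T x) <= hnorm (T v) * hnorm x.
Proof.
  intros HT Hc; destruct (linear_bound T HT) as [L [HL HTL]].
  pose (E := fun r => exists x, perp n e x /\ hnorm x <= 1 /\ r = hnorm (T x)).
  destruct (completeness E) as [M [HMub HMlub]].
  { exists L; intros r [x [_ [Hx ->]]]; eapply Rle_trans; [apply HTL|].
    rewrite <- (Rmult_1_r L) at 2; apply Rmult_le_compat_l; lra. }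
  { exists 0, hzero; split; [apply perp_zero|].
    rewrite linear_zero, hnorm_zero by assumption; lra. }
  assert (HM1 : forall x, perp n e x -> hnorm (T x) <= M * hnorm x).
  { apply bound_of_unit_bound; [exact HT|]; intros x Hx Hx1; apply HMub; exists x; auto. }
  assert (HM0 : 0 <= M).
  { apply HMub; exists hzero; split; [apply perp_zero|].
    rewrite linear_zero, hnorm_zero by assumption; lra. }
  (* If M = 0, T vanishes on the complement and the zero vector serves; the complement may contain
     no unit vector. *)
  destruct HM0 as [HM0|HM0].
  2:{ exists hzero; split; [apply perp_zero|]; split; [auto|]; intros x Hx.
      specialize (HM1 x Hx); rewrite <- HM0, Rmult_0_l in HM1.
      rewrite linear_zero, hnorm_zero by assumption; lra. }
  assert (Hseq : forall k, exists x, perp n e x /\ hnorm x <= 1 /\ M - / (INR k + 1) < hnorm (T x)).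
  { intros k; apply NNPP; intros Hno.
    assert (Hk : 0 < / (INR k + 1)) by apply Rinv_0_lt_compat, INR1_pos.
    assert (M <= M - / (INR k + 1)); [|lra].
    apply HMlub; intros r [x [Hx [Hx1 ->]]]; apply Rnot_lt_le; intros Hlt; apply Hno; eauto. }
  pose (x := fun k => proj1_sig (constructive_indefinite_description _ (Hseq k))).
  assert (Hx : forall k, perp n e (x k) /\ hnorm (x k) <= 1 /\ M - / (INR k + 1) < hnorm (T (x k))).
  { intros k; unfold x; destruct constructive_indefinite_description; assumption. }
  destruct (Hc x) as [phi [Hphi [y Hy]]]; [exists 1; intros; apply Hx|].
  assert (Hy' : forall eps, 0 < eps -> exists N, forall j k, (N <= j)%nat -> (N <= k)%nat ->
    M - eps < hnorm (T (x (phi j))) /\ hnorm (hsub (T (x (phi k))) (T (x (phi j)))) < eps).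
  { intros eps Heps; destruct (converges_cauchy _ _ Hy eps Heps) as [N1 HN1].
    destruct (inv_INR_lt eps Heps) as [N2 HN2]; exists (N1 + N2)%nat; intros j k Hj Hk; split.
    - pose proof (increasing_ge phi Hphi j).
      specialize (HN2 (phi j) ltac:(lia)); destruct (Hx (phi j)) as [_ [_ K]]; lra.
    - apply HN1; lia. }
  destruct (cauchy_converges (fun k => x (phi k))) as [v Hv].
  { intros eps Heps.
    (* This yields |a + b| > 2 - 3 eps^2/16, hence |a + b|^2 >= 4 - 12 eps^2/16, and the
       parallelogram law leaves |a - b|^2 <= 3 eps^2/4. *)
    pose (d := M * (eps * eps) / 16).
    assert (Hd : 0 < d) by (unfold d; apply Rdiv_lt_0_compat; [|lra]; repeat apply Rmult_lt_0_compat; lra).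
    destruct (Hy' d Hd) as [N HN]; exists N; intros k j Hk Hj.
    destruct (HN j k Hj Hk) as [K1 K2].
    set (a := x (phi k)) in *; set (b := x (phi j)) in *.
    destruct (Hx (phi k)) as [Pa [Na _]]; destruct (Hx (phi j)) as [Pb [Nb _]].
    fold a in Pa, Na; fold b in Pb, Nb.
    assert (K3 : 2 * M - 3 * d < M * hnorm (hadd a b)).
    { eapply Rlt_le_trans; [|apply HM1, perp_add; assumption].
      rewrite (proj1 HT).
      assert (K : hnorm (hscal (mkC 2 0) (T b)) <=
        hnorm (hadd (T a) (T b)) + hnorm (hsub (T a) (T b))).
      { replace (hscal (mkC 2 0) (T b)) with (hsub (hadd (T a) (T b)) (hsub (T a) (T b)));
          [apply hnorm_sub|].
        apply inner_ext; intros z; inner_simpl.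
        replace (mkC 2 0) with (Cadd C1 C1) by (apply Cplx_ext; simpl; ring); ring. }
      rewrite hnorm_scal, Cabs_real, Rabs_pos_eq in K by lra; lra. }
    assert (K4 : nsq (hsub a b) = 2 * nsq a + 2 * nsq b - nsq (hadd a b))
      by (rewrite nsq_sub, nsq_add; ring).
    rewrite <- !hnorm_sqr in K4.
    pose proof (hnorm_ge0 a); pose proof (hnorm_ge0 b); pose proof (hnorm_ge0 (hadd a b)).
    pose proof (hnorm_ge0 (hsub a b)).
    assert (K5 : 2 - 3 * (eps * eps) / 16 < hnorm (hadd a b)).
    { apply Rmult_lt_reg_l with M; [exact HM0|]; unfold d in K3; lra. }
    assert (hnorm a * hnorm a <= 1) by nra.
    assert (hnorm b * hnorm b <= 1) by nra.
    assert (0 < eps * eps) by nra.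
    assert (K6 : 4 - 12 * (eps * eps) / 16 <= hnorm (hadd a b) * hnorm (hadd a b)).
    { set (s := hnorm (hadd a b)) in *; nra. }
    assert (K7 : hnorm (hsub a b) * hnorm (hsub a b) < eps * eps) by lra.
    set (s := hnorm (hsub a b)) in *; nra. }
  exists v.
  assert (Pv : perp n e v) by (apply (perp_limit n e _ v) in Hv; auto; intros; apply Hx).
  assert (Nv : nsq v <= 1).
  { apply (Un_cv_le (fun k => nsq (x (phi k)))); [|apply converges_nsq, Hv].
    intros k; rewrite <- hnorm_sqr; pose proof (hnorm_ge0 (x (phi k))).
    destruct (Hx (phi k)) as [_ [K _]]; nra. }
  assert (Mv : M * M <= nsq (T v)).
  { apply le_epsilon; intros eps Heps.
    pose proof (converges_nsq _ _ (converges_linear T _ _ HT Hv)) as Hcv.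
    destruct (Hcv (eps / 2)) as [N1 HN1]; [lra|].
    destruct (Hy' (eps / (4 * M))) as [N2 HN2]; [apply Rdiv_lt_0_compat; lra|].
    specialize (HN1 (N1 + N2)%nat ltac:(lia)).
    destruct (HN2 (N1 + N2)%nat (N1 + N2)%nat ltac:(lia) ltac:(lia)) as [K _].
    unfold Rdist in HN1; apply Rabs_def2 in HN1 as [K1 _].
    set (z := T (x (phi (N1 + N2)%nat))) in *.
    assert (M * (M - hnorm z) <= eps / 4).
    { replace (eps / 4) with (M * (eps / (4 * M))) by (field; lra).
      apply Rmult_le_compat_l; lra. }
    rewrite <- hnorm_sqr in K1; pose proof (hnorm_ge0 z).
    assert (0 <= (M - hnorm z) * (M - hnorm z)) by apply Rle_0_sqr. nra. }
  assert (Lv : nsq (T v) <= M * M * nsq v) by (apply hnorm_le_nsq; auto).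
  (* M^2 <= |Tv|^2 <= M^2 |v|^2 with M > 0 forces |v| >= 1. *)
  assert (Ev : nsq v = 1)
    by (apply Rle_antisym; [exact Nv|apply Rmult_le_reg_l with (M * M); nra]).
  split; [exact Pv|]; split; [left; rewrite inner_self, Ev; reflexivity|].
  intros z Hz; eapply Rle_trans; [apply HM1, Hz|].
  apply Rmult_le_compat_r; [apply hnorm_ge0|].
  rewrite <- hnorm_sqr in Mv; pose proof (hnorm_ge0 (T v)); nra.
Qed.

(** First-order condition at a maximum. Moving u by t a v with a = <Tu,Tv> changes the left side by
    2 t |a|^2 to first order and the right side only to order t^2; t = 1/(K + 1) is small enough to
    force a = 0. *)
Lemma maximizer_variation {H : Hilbert} (T : H -> H) (u v : H) : bounded_linear T ->
  inner u u = C1 -> inner u v = C0 ->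
  (forall c, nsq (T (hadd u (hscal c v))) <= nsq (T u) * nsq (hadd u (hscal c v))) ->
  inner (T u) (T v) = C0.
Proof.
  intros HT Hu Huv Hmax; set (a := inner (T u) (T v)).
  apply Cnorm2_eq0.
  pose (K := nsq (T u) * nsq v).
  assert (HK : 0 <= K) by (apply Rmult_le_pos; apply nsq_ge0).
  assert (Hvar : forall t, 2 * t * Cnorm2 a <= t * t * Cnorm2 a * K).
  { intros t; specialize (Hmax (Cmul (mkC t 0) a)).
    rewrite (proj1 HT), (proj1 (proj2 HT)), !nsq_add, !nsq_scal, !inner_scal_r in Hmax.
    rewrite Huv, Cnorm2_mul in Hmax; fold a in Hmax.
    assert (Eu : nsq u = 1) by (unfold nsq; rewrite Hu; reflexivity).
    rewrite Eu in Hmax.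
    pose proof (nsq_ge0 (T v)); pose proof (Cnorm2_ge0 a).
    assert (0 <= t * t * Cnorm2 a * nsq (T v))
      by (apply Rmult_le_pos; [apply Rmult_le_pos; [apply Rle_0_sqr|]|]; assumption).
    unfold K; unfold Cnorm2 in *; simpl in *; nra. }
  pose proof (Cnorm2_ge0 a).
  specialize (Hvar (/ (K + 1))).
  apply Rmult_le_compat_l with (r := (K + 1) * (K + 1)) in Hvar; [|nra].
  replace ((K + 1) * (K + 1) * (2 * / (K + 1) * Cnorm2 a)) with (2 * (K + 1) * Cnorm2 a)
    in Hvar by (field; lra).
  replace ((K + 1) * (K + 1) * (/ (K + 1) * / (K + 1) * Cnorm2 a * K)) with (K * Cnorm2 a)
    in Hvar by (field; lra).
  nra.
Qed.

(** The last clause is T^*T u_i = |T u_i|^2 u_i tested against v. By the second, |T u_n| is the norm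
    of T on the complement of the earlier vectors, and it is 0 when u_n = 0. *)
Definition singular_system {H : Hilbert} (T : H -> H) (u : nat -> H) : Prop :=
  (forall n, osys n u) /\
  (forall n x, perp n u x -> hnorm (T x) <= hnorm (T (u n)) * hnorm x) /\
  (forall i v, inner (T (u i)) (T v) = Cmul (mkC (nsq (T (u i))) 0) (inner (u i) v)).

Lemma singular_system_exists {H : Hilbert} (T : H -> H) : bounded_linear T -> compact_op T ->
  exists u, singular_system T u.
Proof.
  intros HT Hc.
  destruct (greedy hzero (fun n f v => perp n f v /\ (inner v v = C1 \/ v = hzero) /\
    forall x, perp n f x -> hnorm (T x) <= hnorm (T v) * hnorm x)) as [u Hu].
  { intros n f g v E [K1 [K2 K3]]; split; [eapply perp_ext; eauto|]; split; [exact K2|].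
    intros x Hx; apply K3; eapply perp_ext; [|exact Hx]; intros; symmetry; auto. }
  { intros n f; apply compact_maximizer; assumption. }
  assert (Ho : forall n, osys n u).
  { induction n; [split; intros; lia|]; apply osys_S; [exact IHn| |]; apply Hu. }
  exists u; split; [exact Ho|]; split; [intros n; apply Hu|].
  (* Split v along u_0, ..., u_i. The orthogonal remainder is handled by the variation argument, and
     the components j < i by the induction hypothesis for j tested against u_i. *)
  intros i; induction i as [i IH] using lt_wf_ind; intros v.
  destruct (Hu i) as [Pi [[Ui|Ui] Mi]].
  2:{ rewrite Ui, linear_zero, !inner_zero_l by assumption; ring. }
  assert (Hperp : forall w, perp (S i) u w -> inner (T (u i)) (T w) = C0).
  { intros w Hw; apply maximizer_variation; auto.
    - rewrite inner_conj_sym, Hw by lia; apply Cconj_C0.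
    - intros c; rewrite <- (hnorm_sqr (T (u i))); apply hnorm_le_nsq, Mi.
      apply perp_add; [exact Pi|]; apply perp_scal; eapply perp_le; [|exact Hw]; lia. }
  rewrite <- (proj_resid (S i) u v), (proj1 HT), inner_add_r.
  rewrite (Hperp (resid (S i) u v)) by (apply resid_perp, Ho).
  rewrite inner_add_r.
  rewrite (inner_conj_sym _ (resid (S i) u v) (u i)), (resid_perp (S i) u v (Ho (S i)) i),
    Cconj_C0 by lia.
  rewrite (inner_conj_sym _ (proj (S i) u v) (u i)), inner_proj_self by (auto; lia).
  unfold proj; rewrite linear_hsum, inner_hsum_r by assumption.
  rewrite (csum_single (S i) i) by
    (try lia; intros j Hj Hji; rewrite (proj1 (proj2 HT)), inner_scal_r;
     rewrite (inner_conj_sym _ (T (u j)) (T (u i))), IH by lia;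
     rewrite (proj1 (Ho (S i)) j i) by lia;
     rewrite Cconj_mul, Cconj_C0; ring).
  rewrite (proj1 (proj2 HT)), inner_scal_r, inner_self; ring.
Qed.

Lemma singular_decreasing {H : Hilbert} (T : H -> H) (u : nat -> H) i j : singular_system T u ->
  (i <= j)%nat -> hnorm (T (u j)) <= hnorm (T (u i)).
Proof.
  intros [Ho [Hm _]] Hij.
  eapply Rle_trans; [apply (Hm i); apply (perp_osys i (S j)); auto; lia|].
  rewrite <- (Rmult_1_r (hnorm (T (u i)))) at 2; apply Rmult_le_compat_l; [apply hnorm_ge0|].
  apply (osys_hnorm_le1 (S j) u); auto.
Qed.

(** A truncated singular value decomposition with exact remainder: the eigenvalue relation makes the
    images of the projection and of the residual orthogonal. *)
Lemma singular_decomposition {H : Hilbert} (T : H -> H) (u : nat -> H) n x y :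
  bounded_linear T -> singular_system T u ->
  inner (T x) (T y) =
    Cadd (csum n (fun i => Cmul (mkC (nsq (T (u i))) 0) (Cmul (inner x (u i)) (inner (u i) y))))
      (inner (T (resid n u x)) (T (resid n u y))).
Proof.
  intros HT [Ho [_ Hs]].
  assert (E0 : forall z, inner (T (proj n u z)) (T (resid n u y)) = C0).
  { intros z; unfold proj; rewrite linear_hsum, inner_hsum_l by assumption; apply csum_0.
    intros i Hi; rewrite (proj1 (proj2 HT)), inner_scal_l, Hs.
    rewrite (inner_conj_sym _ (resid n u y) (u i)), resid_perp by auto.
    rewrite Cconj_C0; ring. }
  assert (E1 : forall z, inner (T (proj n u x)) (T z) =
    csum n (fun i => Cmul (mkC (nsq (T (u i))) 0) (Cmul (inner x (u i)) (inner (u i) z)))).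
  { intros z; unfold proj; rewrite linear_hsum, inner_hsum_l by assumption.
    apply csum_ext; intros i Hi; rewrite (proj1 (proj2 HT)), inner_scal_l, Hs; ring. }
  assert (E2 : inner (T (resid n u x)) (T (proj n u y)) = C0).
  { rewrite inner_conj_sym; unfold proj; rewrite linear_hsum, inner_hsum_l by assumption.
    rewrite csum_0; [apply Cconj_C0|].
    intros i Hi; rewrite (proj1 (proj2 HT)), inner_scal_l, Hs.
    rewrite (inner_conj_sym _ (resid n u x) (u i)), resid_perp by auto.
    rewrite Cconj_C0; ring. }
  rewrite <- E1, <- (proj_resid n u x) at 1.
  rewrite (proj1 HT), inner_add_l; f_equal.
  rewrite <- (proj_resid n u y) at 1; rewrite (proj1 HT), inner_add_r, E2; ring.
Qed.

Lemma nsq_singular_decomposition {H : Hilbert} (T : H -> H) (u : nat -> H) n x :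
  bounded_linear T -> singular_system T u ->
  nsq (T x) = rsum n (fun i => Cnorm2 (inner x (u i)) * nsq (T (u i))) + nsq (T (resid n u x)).
Proof.
  intros HT Hs; unfold nsq at 1; rewrite (singular_decomposition T u n x x HT Hs).
  simpl; rewrite csum_re; unfold nsq at 3; f_equal; apply rsum_ext; intros i Hi.
  rewrite (inner_conj_sym _ x (u i)), Cmul_conj; simpl; ring.
Qed.

(** * Schatten class operators and frames *)

Lemma rpow_Cabs z p : rpow (Cabs z) p = rpow (Cnorm2 z) (p / 2).
Proof. rewrite <- Cabs_sqr; symmetry; apply rpow_sqr, Cabs_ge0. Qed.
Lemma rpow_hnorm {H : Hilbert} (x : H) p : rpow (hnorm x) p = rpow (nsq x) (p / 2).
Proof. rewrite <- hnorm_sqr; symmetry; apply rpow_sqr, hnorm_ge0. Qed.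

(** The bound 1 is an infimum, so only constants below 1 + eps' are available. Taking eps' =
    eps/(|x|^2 + 1) makes the excess at most eps. *)
Lemma partial_sum_le_frame_bound {H : Hilbert} (f : nat -> H) x N : upper_frame_bound_le f 1 ->
  rsum N (fun n => Cnorm2 (inner x (f n))) <= nsq x.
Proof.
  intros Hf; apply le_epsilon; intros eps Heps.
  pose proof (nsq_ge0 x) as Hx.
  destruct (Hf (eps / (nsq x + 1))) as [C2 [HC2 Hlt]]; [apply Rdiv_lt_0_compat; lra|].
  destruct (HC2 x) as [l [Hl Hle]]; rewrite hnorm_sqr in Hle.
  assert (K : rsum N (fun n => Cnorm2 (inner x (f n))) <= l).
  { apply Rle_trans with (rsum (S N) (fun n => Cnorm2 (inner x (f n)))).
    - apply rsum_le_idx; [lia|intros; apply Cnorm2_ge0].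
    - rewrite <- sum_f_R0_rsum; apply sum_incr; [exact Hl|intros; apply Cnorm2_ge0]. }
  assert (eps / (nsq x + 1) * nsq x <= eps).
  { apply Rmult_le_reg_r with (nsq x + 1); [lra|].
    replace (eps / (nsq x + 1) * nsq x * (nsq x + 1)) with (eps * nsq x) by (field; lra).
    nra. }
  nra.
Qed.

(** From A^2 u = s^2 u, the vector z = Au - su satisfies Az = -sz. Since A is positive and s > 0, z
    = 0. *)
Lemma singular_vector_eigen {H : Hilbert} (T A : H -> H) (u : nat -> H) i :
  singular_system T u -> is_abs_op T A -> 0 < hnorm (T (u i)) ->
  A (u i) = hscalR (hnorm (T (u i))) (u i).
Proof.
  intros [_ [_ Hs]] [HS [_ [Hpos HSS]]] Hlt; set (s := hnorm (T (u i))) in *.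
  assert (E : A (A (u i)) = hscalR (s * s) (u i)).
  { apply inner_ext; intros z; unfold hscalR; rewrite HSS, Hs, inner_scal_l.
    unfold s; rewrite hnorm_sqr; reflexivity. }
  apply hsub_eq0; set (z := hsub (A (u i)) (hscalR s (u i))).
  assert (Ez : A z = hscalR (- s) z).
  { unfold z; rewrite linear_sub by assumption; unfold hscalR at 1.
    rewrite (proj1 (proj2 HS)), E; apply inner_ext; intros w; unfold hscalR; inner_simpl.
    replace (mkC (s * s) 0) with (Cmul (mkC s 0) (mkC s 0)) by (apply Cplx_ext; simpl; ring).
    replace (mkC (- s) 0) with (Copp (mkC s 0)) by (apply Cplx_ext; simpl; ring); ring. }
  specialize (Hpos z); rewrite Ez in Hpos; unfold hscalR in Hpos.
  rewrite inner_scal_l, inner_self in Hpos; simpl in Hpos.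
  apply nsq_eq0; pose proof (nsq_ge0 z); nra.
Qed.

(** If the last singular value is 0, its term drops out. Otherwise monotonicity makes all earlier
    ones positive, and the u_i form an admissible orthonormal family of eigenvectors. *)
Lemma singular_values_sum {H : Hilbert} (T A : H -> H) (u : nat -> H) p B :
  bounded_linear T -> singular_system T u -> is_abs_op T A ->
  (forall (m : nat) (u : nat -> H) (lam : nat -> R), orthonormal m u ->
    (forall i, (i < m)%nat -> 0 < lam i /\ A (u i) = hscalR (lam i) (u i)) ->
    rsum m (fun i => rpow (lam i) p) <= B) ->
  forall m, rsum m (fun i => rpow (hnorm (T (u i))) p) <= B.
Proof.
  intros HT Hu HS HB; induction m as [|m IH].
  - apply (HB 0%nat u (fun _ => 0)); [intros i j; lia|intros i; lia].
  - destruct (hnorm_ge0 (T (u m))) as [Hm|Hm].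
    2:{ simpl; rewrite <- Hm, rpow_0; lra. }
    assert (Hpos : forall i, (i < S m)%nat -> 0 < hnorm (T (u i))).
    { intros i Hi; eapply Rlt_le_trans; [exact Hm|].
      apply singular_decreasing; [exact Hu|lia]. }
    apply (HB (S m) u).
    + apply osys_orthonormal; [apply Hu|]; intros i Hi E; specialize (Hpos i Hi).
      rewrite E, linear_zero, hnorm_zero in Hpos by assumption; lra.
    + intros i Hi; split; [auto|]; apply (singular_vector_eigen T A); auto.
Qed.

(** A finite version of the Jensen step: the residual of x is one more atom, with weight |resid|^2
    and value |T u_m|^2, and all weights sum to |x|^2 <= 1. *)
Lemma rpow_image_bound {H : Hilbert} (T : H -> H) (u : nat -> H) q m x :
  1 <= q -> bounded_linear T -> singular_system T u -> nsq x <= 1 ->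
  rpow (nsq (T x)) q <=
    rsum m (fun i => Cnorm2 (inner x (u i)) * rpow (nsq (T (u i))) q) + rpow (nsq (T (u m))) q.
Proof.
  intros Hq HT Hu Hx.
  pose (t := fun i => if Nat.eq_dec i m then nsq (resid m u x) else Cnorm2 (inner x (u i))).
  assert (Et : forall g, rsum (S m) (fun i => t i * g i) =
    rsum m (fun i => Cnorm2 (inner x (u i)) * g i) + nsq (resid m u x) * g m).
  { intros g; simpl; f_equal.
    - apply rsum_ext; intros i Hi; unfold t; destruct (Nat.eq_dec i m); [lia|reflexivity].
    - unfold t; destruct (Nat.eq_dec m m); [reflexivity|congruence]. }
  assert (Ht : rsum (S m) t = nsq x).
  { rewrite (pythagoras m u x) by apply Hu.
    rewrite (rsum_ext (S m) t (fun i => t i * 1)) by (intros; ring).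
    rewrite Et, Rmult_1_r; f_equal; apply rsum_ext; intros; ring. }
  assert (Hr : nsq (resid m u x) <= 1)
    by (eapply Rle_trans; [apply nsq_resid_le, Hu|exact Hx]).
  apply Rle_trans with (rpow (rsum (S m) (fun i => t i * nsq (T (u i)))) q).
  - apply rpow_le; [lra|apply nsq_ge0|].
    rewrite (nsq_singular_decomposition T u m x HT Hu), Et; apply Rplus_le_compat_l.
    rewrite Rmult_comm, <- (hnorm_sqr (T (u m))).
    apply hnorm_le_nsq, Hu, resid_perp, Hu.
  - eapply Rle_trans.
    + apply (rpow_jensen (S m) t (fun i => nsq (T (u i)))); [exact Hq| | |lra].
      * intros i _; unfold t; destruct (Nat.eq_dec i m); [apply nsq_ge0|apply Cnorm2_ge0].
      * intros; apply nsq_ge0.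
    + rewrite (Et (fun i => rpow (nsq (T (u i))) q)); apply Rplus_le_compat_l.
      pose proof (rpow_ge0 (nsq (T (u m))) q); pose proof (nsq_ge0 (resid m u x)); nra.
Qed.

Lemma Sp_frame_bound {H : Hilbert} (p : R) (T : H -> H) : 2 <= p -> bounded_linear T ->
  in_Sp p T -> exists C, 0 < C /\ forall f : nat -> H,
    upper_frame_bound_le f 1 -> double_sum_le T f p C.
Proof.
  intros Hp HT [Hc [A [HS [B HB]]]].
  destruct (singular_system_exists T HT Hc) as [u Hu].
  pose proof (singular_values_sum T A u p B HT Hu HS HB) as Hsum.
  assert (HB0 : 0 <= B) by (apply (Hsum 0%nat)).
  assert (Hq : 1 <= p / 2) by lra.
  (* [B] pays for the singular values, 1 for the N truncation errors |T u_m|^p. *)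
  exists (B + 1); split; [lra|]; intros f Hf N K.
  assert (Hfx : forall n x, rsum n (fun k => Cnorm2 (inner x (f k))) <= nsq x)
    by (intros; apply partial_sum_le_frame_bound, Hf).
  (* The frame bound tested at f_n itself gives |f_n|^4 <= |f_n|^2. *)
  assert (Hf1 : forall n, nsq (f n) <= 1).
  { intros n; pose proof (nsq_ge0 (f n)).
    assert (E : Cnorm2 (inner (f n) (f n)) <= nsq (f n)).
    { eapply Rle_trans; [|apply (Hfx (S n))].
      apply (rsum_term (S n) n (fun k => Cnorm2 (inner (f n) (f k)))); [lia|].
      intros; apply Cnorm2_ge0. }
    rewrite inner_self in E; unfold Cnorm2 in E; simpl in E; nra. }
  apply Rle_trans with (rsum N (fun n => rpow (nsq (T (f n))) (p / 2))).
  { apply rsum_le; intros n _.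
    rewrite (rsum_ext K _ (fun k => rpow (Cnorm2 (inner (T (f n)) (f k))) (p / 2)))
      by (intros; apply rpow_Cabs).
    apply rpow_superadditive; [exact Hq|intros; apply Cnorm2_ge0|apply Hfx]. }
  (* The truncation index depends on N: as (m + 1) |T u_m|^p <= B, m > N B makes N |T u_m|^p at most
     1. *)
  destruct (inv_INR_lt (/ (INR N * B + 1))) as [m Hm].
  { apply Rinv_0_lt_compat; pose proof (pos_INR N); nra. }
  specialize (Hm m (le_n m)).
  assert (HNB : 0 <= INR N * B) by (apply Rmult_le_pos; [apply pos_INR|exact HB0]).
  apply Rle_trans with (rsum N (fun n =>
    rsum m (fun i => Cnorm2 (inner (f n) (u i)) * rpow (nsq (T (u i))) (p / 2)) +
    rpow (nsq (T (u m))) (p / 2))).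
  { apply rsum_le; intros n _; apply rpow_image_bound; auto. }
  rewrite rsum_add, rsum_const, rsum_exchange; apply Rplus_le_compat.
  - eapply Rle_trans; [|apply (Hsum m)]; apply rsum_le; intros i Hi.
    rewrite rpow_hnorm.
    rewrite (rsum_ext N _ (fun n => rpow (nsq (T (u i))) (p / 2) * Cnorm2 (inner (u i) (f n))))
      by (intros; rewrite (inner_conj_sym _ (u i)), Cnorm2_conj; ring).
    rewrite rsum_mul; rewrite <- (Rmult_1_r (rpow _ _)) at 2.
    apply Rmult_le_compat_l; [apply rpow_ge0|].
    eapply Rle_trans; [apply Hfx|].
    pose proof (osys_hnorm_le1 (S i) u i (proj1 Hu _) ltac:(lia)).
    rewrite <- hnorm_sqr; pose proof (hnorm_ge0 (u i)); nra.
  - (* the singular values decrease, so the last one is controlled by the sum *)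
    assert (Hmm : (INR m + 1) * rpow (nsq (T (u m))) (p / 2) <= B).
    { eapply Rle_trans; [|apply (Hsum (S m))].
      rewrite <- S_INR, <- rsum_const; apply rsum_le; intros i Hi.
      rewrite rpow_hnorm; apply rpow_le; [lra|apply nsq_ge0|].
      rewrite <- !hnorm_sqr.
      pose proof (singular_decreasing T u i m Hu ltac:(lia)).
      pose proof (hnorm_ge0 (T (u m))); nra. }
    pose proof (INR1_pos m).
    assert (Hmlt : INR N * B + 1 < INR m + 1).
    { apply Rnot_le_lt; intros Hle; apply Rinv_le_contravar in Hle; lra. }
    pose proof (rpow_ge0 (nsq (T (u m))) (p / 2)) as Hr; set (r := rpow _ _) in *.
    pose proof (pos_INR N).
    destruct (Rle_lt_dec (INR N * r) 1) as [|Hgt]; [assumption|exfalso].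
    assert (INR N * ((INR m + 1) * r) <= INR N * B) by (apply Rmult_le_compat_l; lra).
    nra.
Qed.

(** A basis is given by totality, so completeness enters: the projections of x converge, and x minus
    their limit is orthogonal to every e_k, hence zero. *)
Lemma orthonormal_basis_parseval {H : Hilbert} (e : nat -> H) x : orthonormal_basis e ->
  infinite_sum (fun n => Cnorm2 (inner x (e n))) (nsq x).
Proof.
  intros [He Htot].
  assert (Ho : forall n, osys n e) by (intros n; apply orthonormal_osys; intros i j _ _; apply He).
  pose (s := fun n => rsum n (fun i => Cnorm2 (inner x (e i)))).
  assert (Hdiff : forall m n, (m <= n)%nat ->
    nsq (hsub (proj n e x) (proj m e x)) = s n - s m).
  { intros m n Hmn; rewrite nsq_sub, !nsq_proj by apply Ho; fold (s n) (s m).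
    rewrite inner_conj_sym, inner_proj_l; simpl; rewrite csum_re.
    rewrite (rsum_ext m _ (fun i => Cnorm2 (inner x (e i)))); [fold (s m); ring|].
    intros i Hi; rewrite (inner_conj_sym _ (proj n e x) (e i)), inner_proj_self by (auto; lia).
    rewrite Cmul_conj; reflexivity. }
  destruct (converges_of_increments (fun n => proj n e x) s (nsq x) Hdiff) as [y Hy].
  { intros n; apply bessel, Ho. }
  assert (Exy : x = y).
  { apply hsub_eq0, Htot; intros k; rewrite inner_sub_l.
    assert (E : Ccv (fun n => inner (proj n e x) (e k)) (inner x (e k))).
    { split; intros eps Heps; exists (S k); intros n Hn; rewrite inner_proj_self by (auto; lia);
        unfold Rdist; rewrite Rminus_diag, Rabs_R0; exact Heps. }
    rewrite (Ccv_unique _ _ _ E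
      (converges_inner _ (fun _ => e k) _ _ Hy (converges_const (e k)))); ring. }
  pose proof (converges_nsq _ _ Hy) as K; rewrite <- Exy in K.
  intros eps Heps; destruct (K eps Heps) as [N HN]; exists N; intros n Hn.
  rewrite sum_f_R0_rsum, <- nsq_proj by apply Ho; apply HN; lia.
Qed.

Lemma orthonormal_basis_frame {H : Hilbert} (e : nat -> H) : orthonormal_basis e ->
  is_frame e /\ upper_frame_bound_le e 1.
Proof.
  intros He; split.
  - exists 1, 1; split; [lra|]; intros x; exists (nsq x).
    rewrite hnorm_sqr; split; [apply orthonormal_basis_parseval, He|lra].
  - intros eps Heps; exists 1; split; [|lra]; intros x; exists (nsq x).
    rewrite hnorm_sqr; split; [apply orthonormal_basis_parseval, He|lra].
Qed.

(** * The modulus of a compact operator *)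

(** The T u_i are mutually orthogonal. If their norms stayed above eps, any two would be more than
    eps apart and no subsequence could converge. *)
Lemma singular_values_cv0 {H : Hilbert} (T : H -> H) (u : nat -> H) :
  bounded_linear T -> compact_op T -> singular_system T u ->
  Un_cv (fun n => hnorm (T (u n))) 0.
Proof.
  intros HT Hc Hu.
  assert (Hex : forall eps, 0 < eps -> exists n, hnorm (T (u n)) < eps).
  { intros eps Heps; apply NNPP; intros Hno.
    assert (Hge : forall n, eps <= hnorm (T (u n)))
      by (intros n; apply Rnot_lt_le; intros Hlt; apply Hno; eauto).
    destruct (Hc u) as [phi [Hphi [l Hl]]].
    { exists 1; intros n; apply (osys_hnorm_le1 (S n)); [apply Hu|lia]. }
    destruct (converges_cauchy _ _ Hl eps Heps) as [N HN].
    specialize (HN N (S N) ltac:(lia) ltac:(lia)).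
    assert (E : nsq (hsub (T (u (phi N))) (T (u (phi (S N))))) =
      nsq (T (u (phi N))) + nsq (T (u (phi (S N))))).
    { rewrite nsq_sub; destruct Hu as [Ho [_ Hs]]; rewrite Hs.
      pose proof (Hphi N); rewrite (proj1 (Ho (S (phi (S N))))) by lia; simpl; ring. }
    rewrite <- !hnorm_sqr in E.
    pose proof (hnorm_ge0 (hsub (T (u (phi N))) (T (u (phi (S N)))))).
    pose proof (Hge (phi N)); pose proof (Hge (phi (S N))).
    set (z := hnorm (hsub _ _)) in *; nra. }
  intros eps Heps; destruct (Hex eps Heps) as [N HN]; exists N; intros n Hn.
  unfold Rdist; rewrite Rminus_0_r, Rabs_pos_eq by apply hnorm_ge0.
  eapply Rle_lt_trans; [apply (singular_decreasing T u N n Hu Hn)|exact HN].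
Qed.

Lemma inner_osys_combination {H : Hilbert} n (u : nat -> H) (c : nat -> Cplx) k :
  osys n u -> (k < n)%nat ->
  inner (hsum n (fun i => hscal (c i) (u i))) (u k) = Cmul (c k) (inner (u k) (u k)).
Proof.
  intros [Hu _] Hk; rewrite inner_hsum_l, (csum_single n k); [apply inner_scal_l|exact Hk|].
  intros i Hi Hik; rewrite inner_scal_l, Hu by assumption; ring.
Qed.

(** |T| x is the limit of the sums of s_i <x,u_i> u_i with s_i = |T u_i|. Squaring the truncation
    reproduces [singular_decomposition] up to a remainder of size at most s_n^2 |x| |y|, which tends
    to 0. *)
Lemma abs_op_exists {H : Hilbert} (T : H -> H) : bounded_linear T -> compact_op T ->
  exists A, is_abs_op T A.
Proof.
  intros HT Hc; destruct (singular_system_exists T HT Hc) as [u Hu].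
  pose proof (singular_values_cv0 T u HT Hc Hu) as Hs0.
  pose (s := fun i => hnorm (T (u i))); change (Un_cv s 0) in Hs0.
  pose (An := fun n x => hsum n (fun i => hscal (Cmul (mkC (s i) 0) (inner x (u i))) (u i))).
  assert (EA : forall n x y, inner (An n x) y =
    csum n (fun i => Cmul (mkC (s i) 0) (Cmul (inner x (u i)) (inner (u i) y)))).
  { intros n x y; unfold An; rewrite inner_hsum_l; apply csum_ext; intros i _.
    rewrite inner_scal_l; ring. }
  assert (EAu : forall n x k, (k < n)%nat ->
    inner (An n x) (u k) = Cmul (mkC (s k) 0) (inner x (u k))).
  { intros n x k Hk; unfold An.
    rewrite (inner_osys_combination n u (fun i => Cmul (mkC (s i) 0) (inner x (u i))))
      by (auto; apply Hu).
    destruct (proj2 (proj1 Hu n) k Hk) as [->| ->]; [ring|rewrite !inner_zero_r; ring]. }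
  assert (EAA : forall m n x y, (m <= n)%nat -> inner (An m x) (An n y) =
    csum m (fun i => Cmul (mkC (nsq (T (u i))) 0) (Cmul (inner x (u i)) (inner (u i) y)))).
  { intros m n x y Hmn; rewrite EA; apply csum_ext; intros i Hi.
    rewrite (inner_conj_sym _ (An n y) (u i)), EAu, Cconj_mul, <- inner_conj_sym by lia.
    replace (mkC (nsq (T (u i))) 0) with (Cmul (mkC (s i) 0) (mkC (s i) 0))
      by (apply Cplx_ext; unfold s; simpl; rewrite <- ?hnorm_sqr; ring).
    replace (Cconj (mkC (s i) 0)) with (mkC (s i) 0) by (apply Cplx_ext; simpl; ring); ring. }
  assert (Hlim : forall x, exists z, converges (fun n => An n x) z).
  { intros x.
    pose (Q := fun n => rsum n (fun i => Cnorm2 (inner x (u i)) * nsq (T (u i)))).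
    assert (EQ : forall m n, (m <= n)%nat -> re (inner (An m x) (An n x)) = Q m).
    { intros m n Hmn; rewrite EAA, csum_re by exact Hmn; apply rsum_ext; intros i _.
      rewrite (inner_conj_sym _ x (u i)), Cmul_conj; simpl; ring. }
    apply (converges_of_increments _ Q (nsq (T x))).
    - intros m n Hmn; rewrite nsq_sub; unfold nsq.
      rewrite (inner_conj_sym _ (An m x) (An n x)); simpl.
      rewrite !EQ by lia; ring.
    - intros n; rewrite (nsq_singular_decomposition T u n x HT Hu); fold (Q n).
      pose proof (nsq_ge0 (T (resid n u x))); lra. }
  (* The limits are chosen separately for each x, so linearity and symmetry are recovered from
     uniqueness of limits. *)
  pose (A := fun x => proj1_sig (constructive_indefinite_description _ (Hlim x))).
  assert (HA : forall x, converges (fun n => An n x) (A x)).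
  { intros x; unfold A; destruct constructive_indefinite_description; assumption. }
  assert (HAi : forall x y, Ccv (fun n => inner (An n x) y) (inner (A x) y)).
  { intros x y; apply (converges_inner _ (fun _ => y)); [apply HA|apply converges_const]. }
  assert (Hself : forall x y, inner (A x) y = inner x (A y)).
  { intros x y; apply (Ccv_unique _ _ _ (HAi x y)).
    apply Ccv_ext with (fun n => inner x (An n y)).
    - intros n; rewrite (inner_conj_sym _ (An n y) x), !EA, csum_conj; apply csum_ext.
      intros i _; rewrite !Cconj_mul, <- !inner_conj_sym.
      replace (Cconj (mkC (s i) 0)) with (mkC (s i) 0) by (apply Cplx_ext; simpl; ring); ring.
    - apply (converges_inner (fun _ => x)); [apply converges_const|apply HA]. }
  assert (Hsq : forall x y, inner (A x) (A y) = inner (T x) (T y)).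
  { intros x y.
    apply (Ccv_unique _ _ _ (converges_inner _ _ _ _ (HA x) (HA y))).
    apply Ccv_squeeze with (fun n => s n * s n * (hnorm x * hnorm y)).
    - intros n; rewrite EAA by lia; rewrite (singular_decomposition T u n x y HT Hu).
      match goal with |- Cabs (Csub ?a (Cadd ?a ?b)) <= _ =>
        replace (Csub a (Cadd a b)) with (Copp b) by ring end.
      rewrite Cabs_opp; eapply Rle_trans; [apply cauchy_schwarz|].
      assert (K : forall z, hnorm (T (resid n u z)) <= s n * hnorm z).
      { intros z; eapply Rle_trans; [apply Hu, resid_perp, Hu|].
        apply Rmult_le_compat_l; [apply hnorm_ge0|apply hnorm_resid_le, Hu]. }
      replace (s n * s n * (hnorm x * hnorm y)) with ((s n * hnorm x) * (s n * hnorm y)) by ring.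
      apply Rmult_le_compat; auto using hnorm_ge0.
    - replace 0 with (0 * 0 * (hnorm x * hnorm y)) by ring.
      repeat apply CV_mult; auto using Un_cv_const. }
  exists A; split; [|split; [exact Hself|split]].
  - split; [|split].
    + intros x y; apply inner_ext; intros z; rewrite inner_add_l.
      apply (Ccv_unique _ _ _ (HAi (hadd x y) z)).
      apply Ccv_ext with (fun n => Cadd (inner (An n x) z) (inner (An n y) z));
        [|apply Ccv_add; apply HAi].
      intros n; rewrite !EA, <- csum_add; apply csum_ext; intros i _.
      rewrite inner_add_l; ring.
    + intros a x; apply inner_ext; intros z; rewrite inner_scal_l.
      apply (Ccv_unique _ _ _ (HAi (hscal a x) z)).
      apply Ccv_ext with (fun n => Cmul a (inner (An n x) z)); [|apply Ccv_mul, HAi].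
      intros n; rewrite !EA, <- csum_mul; apply csum_ext; intros i _.
      rewrite inner_scal_l; ring.
    + destruct (linear_bound T HT) as [M [_ HM]]; exists M; intros x.
      unfold hnorm at 1; rewrite Hsq; apply HM.
  - intros x; apply (Un_cv_ge (fun n => re (inner (An n x) x))); [|apply HAi].
    intros n; rewrite EA, csum_re; apply rsum_ge0; intros i _.
    rewrite (inner_conj_sym _ x (u i)), Cmul_conj; simpl.
    pose proof (Cnorm2_ge0 (inner x (u i))); pose proof (hnorm_ge0 (T (u i))).
    fold (s i) in *; nra.
  - intros x y; rewrite Hself; apply Hsq.
Qed.

(** * Extension to orthonormal bases *)

(** What is retained of the condition on bases. Being about finite families, it keeps its content in
    finite dimension. *)
Definition diag_bounded {H : Hilbert} (T : H -> H) (p C : R) : Prop :=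
  forall m (x : nat -> H), orthonormal m x ->
    rsum m (fun i => rpow (Cabs (inner (T (x i)) (x i))) p) <= C.

Lemma orthonormal_S {H : Hilbert} n (e : nat -> H) : orthonormal n e -> perp n e (e n) ->
  inner (e n) (e n) = C1 -> orthonormal (S n) e.
Proof.
  intros He Hp H1 i j Hi Hj.
  destruct (Nat.eq_dec i j) as [<-|Hij].
  - destruct (Nat.eq_dec i n) as [->|]; [exact H1|].
    rewrite He by lia; destruct (Nat.eq_dec i i); congruence.
  - apply (osys_S n e (orthonormal_osys n e He) Hp (or_introl H1)); assumption.
Qed.

(** The first hypothesis is infinite dimension. Past index m, step n absorbs the dense vector
    d_(n-m) into the span, so a vector orthogonal to the whole sequence is orthogonal to a dense
    set. *)
Lemma basis_extension {H : Hilbert} m (x : nat -> H) :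
  (forall n (e : nat -> H), orthonormal n e -> exists v, inner v v = C1 /\ perp n e v) ->
  orthonormal m x ->
  exists e, orthonormal_basis e /\ forall i, (i < m)%nat -> e i = x i.
Proof.
  intros Hinf Hx; destruct (hseparable H) as [d Hd].
  destruct (greedy hzero (fun n f v => ((n < m)%nat -> v = x n) /\
    ((m <= n)%nat -> orthonormal n f -> inner v v = C1 /\ perp n f v /\
      forall y, perp n f y -> inner y v = C0 -> inner y (d (n - m)%nat) = C0))) as [e He].
  { intros n f g v E [K1 K2]; split; [exact K1|]; intros Hn Hg.
    destruct (K2 Hn) as [L1 [L2 L3]].
    - intros i j Hi Hj; rewrite !E by assumption; auto.
    - split; [exact L1|]; split; [eapply perp_ext; eauto|].
      intros y Hy; apply L3; eapply perp_ext; [|exact Hy]; intros; symmetry; auto. }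
  { intros n f; destruct (Nat.lt_ge_cases n m) as [Hn|Hn].
    { exists (x n); split; [reflexivity|lia]. }
    destruct (classic (orthonormal n f)) as [Hf|Hf].
    2:{ exists hzero; split; [lia|contradiction]. }
    pose proof (orthonormal_osys n f Hf) as Ho.
    set (r := resid n f (d (n - m)%nat)).
    assert (Hdr : forall y, perp n f y -> inner y (d (n - m)%nat) = inner y r).
    { intros y Hy; rewrite <- (proj_resid n f (d (n - m)%nat)); fold r.
      rewrite inner_add_r, (inner_conj_sym _ (proj n f (d (n - m)%nat)) y), perp_proj by exact Hy.
      rewrite Cconj_C0; ring. }
    (* If d_(n-m) already lies in the span, any new unit vector will do; otherwise its normalized
       residual is taken. *)
    destruct (classic (r = hzero)) as [Hr|Hr].
    - destruct (Hinf n f Hf) as [v [Hv1 Hv2]]; exists v; split; [lia|]; intros _ _.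
      split; [exact Hv1|]; split; [exact Hv2|]; intros y Hy _.
      rewrite Hdr, Hr by exact Hy; apply inner_zero_r.
    - destruct (normalize r Hr) as [a [Ha Ea]]; exists (hscal a r); split; [lia|]; intros _ _.
      split; [exact Ha|]; split; [apply perp_scal, resid_perp, Ho|].
      intros y Hy E; rewrite Hdr by exact Hy; rewrite inner_scal_r in E.
      apply Cnorm2_eq0; apply (f_equal Cnorm2) in E.
      rewrite Cnorm2_mul, Cnorm2_conj, Cnorm2_C0 in E.
      destruct (Rmult_integral _ _ E) as [E0|E0]; [exfalso|exact E0].
      rewrite Ea in E0; unfold Cnorm2 in E0; simpl in E0.
      assert (hnorm r <> 0) by (intros K; apply Hr, hnorm_eq0, K).
      assert (/ hnorm r <> 0) by (apply Rinv_neq_0_compat; assumption).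
      nra. }
  assert (Ex : forall i, (i < m)%nat -> e i = x i) by (intros i; apply He).
  assert (Ho : forall n, orthonormal n e).
  { induction n as [|n IH]; [intros i j; lia|].
    destruct (Nat.lt_ge_cases n m) as [Hn|Hn].
    - intros i j Hi Hj; rewrite !Ex by lia; apply Hx; lia.
    - destruct (proj2 (He n) Hn IH) as [K1 [K2 _]]; apply orthonormal_S; assumption. }
  exists e; split; [split|exact Ex].
  - intros n k; apply (Ho (n + S k)%nat); lia.
  - intros y Hy; apply NNPP; intros Hne.
    assert (Hd0 : forall k, inner y (d k) = C0).
    { intros k; destruct (proj2 (He (k + m)%nat) ltac:(lia) (Ho _)) as [_ [_ K]].
      replace (k + m - m)%nat with k in K by lia; apply K; [intros j _|]; apply Hy. }
    assert (Hpos : 0 < hnorm y).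
    { destruct (hnorm_ge0 y) as [|E]; [assumption|exfalso; apply Hne, hnorm_eq0; auto]. }
    destruct (Hd y (hnorm y) Hpos) as [k Hk].
    change (hnorm (hsub y (d k)) < hnorm y) in Hk.
    (* As y is orthogonal to d_k, |y|^2 = <y, y - d_k> <= |y| |y - d_k| < |y|^2, a contradiction. *)
    pose proof (cauchy_schwarz y (hsub y (d k))) as K.
    rewrite inner_sub_r, Hd0 in K.
    replace (Csub (inner y y) C0) with (mkC (nsq y) 0) in K by (rewrite inner_self; ring).
    rewrite Cabs_real, Rabs_pos_eq, <- hnorm_sqr in K by apply nsq_ge0.
    nra.
Qed.

(** Double counting of the sum of |<x_i,g_j>|^2: each row sums to 1 because g is total, each column
    to at most 1 by Bessel. *)
Lemma orthonormal_card_le {H : Hilbert} r (g : nat -> H) m (x : nat -> H) :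
  orthonormal r g -> (forall v, perp r g v -> v = hzero) -> orthonormal m x -> INR m <= INR r.
Proof.
  intros Hg Htot Hx.
  pose proof (orthonormal_osys r g Hg) as Hgo; pose proof (orthonormal_osys m x Hx) as Hxo.
  assert (H1 : forall n (e : nat -> H) i, orthonormal n e -> (i < n)%nat -> nsq (e i) = 1).
  { intros n e i He Hi; unfold nsq; rewrite He by assumption.
    destruct (Nat.eq_dec i i); [reflexivity|congruence]. }
  rewrite <- (Rmult_1_r (INR m)), <- (Rmult_1_r (INR r)), <- !rsum_const.
  apply Rle_trans with (rsum m (fun i => rsum r (fun j => Cnorm2 (inner (x i) (g j))))).
  - apply rsum_le; intros i Hi; rewrite <- (H1 m x i Hx Hi), (pythagoras r g (x i) Hgo).
    rewrite (Htot (resid r g (x i))), nsq_zero by (apply resid_perp, Hgo); lra.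
  - rewrite rsum_exchange; apply rsum_le; intros j Hj; rewrite <- (H1 r g j Hg Hj).
    eapply Rle_trans; [|apply (bessel m x (g j) Hxo)]; right; apply rsum_ext; intros i _.
    rewrite (inner_conj_sym _ (g j) (x i)), Cnorm2_conj; reflexivity.
Qed.

(** In infinite dimension every finite orthonormal family extends to a basis, whose diagonal terms
    are part of the double sum. Otherwise some finite family g of size r is total, and r |T|^p is a
    bound. *)
Lemma diag_bounded_of_bases {H : Hilbert} (T : H -> H) (p C : R) :
  0 < p -> bounded_linear T ->
  (forall e : nat -> H, orthonormal_basis e -> double_sum_le T e p C) ->
  exists C', diag_bounded T p C'.
Proof.
  intros Hp HT HC.
  destruct (classic (forall n (e : nat -> H), orthonormal n e ->
    exists v, inner v v = C1 /\ perp n e v)) as [Hinf|Hfin].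
  - exists C; intros m x Hx; destruct (basis_extension m x Hinf Hx) as [e [He Ex]].
    eapply Rle_trans; [|apply (HC e He m m)].
    apply rsum_le; intros i Hi; rewrite <- Ex by exact Hi.
    apply (rsum_term m i (fun k => rpow (Cabs (inner (T (e i)) (e k))) p)); [exact Hi|].
    intros; apply rpow_ge0.
  - apply not_all_ex_not in Hfin as [r Hr]; apply not_all_ex_not in Hr as [g Hg].
    apply imply_to_and in Hg as [Hg Hno].
    assert (Htot : forall v, perp r g v -> v = hzero).
    { intros v Hv; apply NNPP; intros Hnz; apply Hno.
      destruct (normalize v Hnz) as [a [Ha _]]; exists (hscal a v); split; [exact Ha|].
      apply perp_scal, Hv. }
    destruct (linear_bound T HT) as [L [HL HTL]].
    exists (INR r * rpow L p); intros m x Hx.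
    apply Rle_trans with (INR m * rpow L p).
    + rewrite <- rsum_const; apply rsum_le; intros i Hi.
      apply rpow_le; [exact Hp|apply Cabs_ge0|].
      eapply Rle_trans; [apply cauchy_schwarz|].
      assert (E : hnorm (x i) = 1).
      { apply hnorm_one; rewrite Hx by exact Hi; destruct (Nat.eq_dec i i); congruence. }
      specialize (HTL (x i)); rewrite E in *; lra.
    + apply Rmult_le_compat_r; [apply rpow_ge0|].
      apply (orthonormal_card_le r g m x); assumption.
Qed.

(** * Greedy vectors for the quadratic form *)

Definition numval {H : Hilbert} (T : H -> H) (x : H) : R := Cabs (inner (T x) x).

Definition numerical_system {H : Hilbert} (T : H -> H) (e : nat -> H) : Prop :=
  (forall n, osys n e) /\
  (forall n x, perp n e x -> numval T x <= 2 * numval T (e n) * nsq x).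

Lemma numval_scal {H : Hilbert} (T : H -> H) a x : bounded_linear T ->
  numval T (hscal a x) = Cnorm2 a * numval T x.
Proof.
  intros HT; unfold numval; rewrite (proj1 (proj2 HT)), inner_scal_l, inner_scal_r, !Cabs_mul.
  rewrite <- Cabs_sqr; unfold Cabs at 2; rewrite Cnorm2_conj; fold (Cabs a); ring.
Qed.

(** Any admissible vector whose value exceeds half the supremum M works, so attainment is not at
    issue. When M = 0, the zero vector is chosen. *)
Lemma numerical_almost_maximizer {H : Hilbert} (T : H -> H) n (e : nat -> H) :
  bounded_linear T -> exists v, perp n e v /\ (inner v v = C1 \/ v = hzero) /\
    forall x, perp n e x -> numval T x <= 2 * numval T v * nsq x.
Proof.
  intros HT; destruct (linear_bound T HT) as [L [HL HTL]].
  pose (E := fun r => exists x, perp n e x /\ (inner x x = C1 \/ x = hzero) /\ r = numval T x).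
  assert (HE0 : E 0).
  { exists hzero; split; [apply perp_zero|]; split; [auto|].
    unfold numval; rewrite inner_zero_r, Cabs_C0; reflexivity. }
  destruct (completeness E) as [M [HMub HMlub]]; [|exists 0; exact HE0|].
  { exists L; intros r [x [_ [Hx ->]]]; unfold numval.
    eapply Rle_trans; [apply cauchy_schwarz|]; specialize (HTL x).
    destruct Hx as [Hx| ->].
    - rewrite (hnorm_one _ Hx) in *; lra.
    - rewrite hnorm_zero; lra. }
  assert (HM0 : 0 <= M) by (apply HMub, HE0).
  assert (HM : forall x, perp n e x -> numval T x <= M * nsq x).
  { intros x Hx; destruct (classic (x = hzero)) as [->|Hnz].
    - unfold numval; rewrite inner_zero_r, Cabs_C0, nsq_zero; lra.
    - destruct (normalize x Hnz) as [a [Ha Ea]].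
      assert (K : numval T (hscal a x) <= M).
      { apply HMub; exists (hscal a x); split; [apply perp_scal, Hx|auto]. }
      rewrite numval_scal in K by exact HT.
      assert (Hpos : 0 < nsq x).
      { destruct (nsq_ge0 x) as [|K']; [assumption|exfalso; apply Hnz, nsq_eq0; auto]. }
      assert (Ea2 : Cnorm2 a * nsq x = 1).
      { rewrite <- nsq_scal; unfold nsq; rewrite Ha; reflexivity. }
      apply Rmult_le_compat_l with (r := nsq x) in K; [|lra].
      replace (nsq x * (Cnorm2 a * numval T x)) with (Cnorm2 a * nsq x * numval T x) in K by ring.
      rewrite Ea2 in K; lra. }
  destruct HM0 as [HM0|HM0].
  - destruct (classic (exists v, perp n e v /\ (inner v v = C1 \/ v = hzero) /\ M / 2 < numval T v))
      as [[v [Hv1 [Hv2 Hv3]]]|Hno].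
    + exists v; split; [exact Hv1|]; split; [exact Hv2|]; intros x Hx.
      eapply Rle_trans; [apply HM, Hx|]; apply Rmult_le_compat_r; [apply nsq_ge0|lra].
    + exfalso; assert (M <= M / 2); [|lra].
      apply HMlub; intros r [x [Hx1 [Hx2 ->]]]; apply Rnot_lt_le; intros Hlt; apply Hno; eauto.
  - exists hzero; split; [apply perp_zero|]; split; [auto|]; intros x Hx.
    specialize (HM x Hx); rewrite <- HM0 in HM.
    unfold numval at 2; rewrite inner_zero_r, Cabs_C0; lra.
Qed.

Lemma numerical_system_exists {H : Hilbert} (T : H -> H) : bounded_linear T ->
  exists e, numerical_system T e.
Proof.
  intros HT.
  destruct (greedy hzero (fun n f v => perp n f v /\ (inner v v = C1 \/ v = hzero) /\
    forall x, perp n f x -> numval T x <= 2 * numval T v * nsq x)) as [e He].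
  { intros n f g v E [K1 [K2 K3]]; split; [eapply perp_ext; eauto|]; split; [exact K2|].
    intros x Hx; apply K3; eapply perp_ext; [|exact Hx]; intros; symmetry; auto. }
  { intros n f; apply numerical_almost_maximizer, HT. }
  exists e; split; [|intros n; apply He].
  induction n; [split; intros; lia|]; apply osys_S; [exact IHn| |]; apply He.
Qed.

(** Once a greedy vector is zero, the form vanishes on its complement and all later values are 0.
    Before that the vectors are orthonormal and [diag_bounded] applies. *)
Lemma numerical_values_sum {H : Hilbert} (T : H -> H) (e : nat -> H) p C :
  numerical_system T e -> diag_bounded T p C ->
  forall N, rsum N (fun n => rpow (numval T (e n)) p) <= C.
Proof.
  intros [Ho Hm] HC; induction N as [|N IH].
  - apply (HC 0%nat e); intros i j; lia.
  - destruct (classic (exists n, (n <= N)%nat /\ e n = hzero)) as [[n [Hn En]]|Hno].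
    + assert (E0 : numval T (e n) = 0)
        by (unfold numval; rewrite En, inner_zero_r, Cabs_C0; reflexivity).
      assert (EN : numval T (e N) = 0).
      { apply Rle_antisym; [|apply Cabs_ge0].
        eapply Rle_trans; [apply (Hm n), (perp_osys n (S N)); auto; lia|].
        rewrite E0; lra. }
      simpl; rewrite EN, rpow_0; lra.
    + apply (HC (S N) e), osys_orthonormal; [apply Ho|].
      intros i Hi E; apply Hno; exists i; split; [lia|exact E].
Qed.

(** 4 <Tx,y> is a combination of the form at x + a y, a = 1, -1, i, -i, with unimodular
    coefficients, and those four squared norms sum to 4 (|x|^2 + |y|^2). *)
Lemma polarization_bound {H : Hilbert} (T : H -> H) n (e : nat -> H) x y :
  bounded_linear T -> numerical_system T e -> perp n e x -> perp n e y ->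
  Cabs (inner (T x) y) <= 2 * numval T (e n) * (nsq x + nsq y).
Proof.
  intros HT [_ Hm] Hx Hy; set (w := numval T (e n)) in *.
  pose (B := fun a => inner (T (hadd x (hscal a y))) (hadd x (hscal a y))).
  assert (HB : forall a, Cabs (B a) <= 2 * w * nsq (hadd x (hscal a y))).
  { intros a; apply Hm, perp_add; [exact Hx|apply perp_scal, Hy]. }
  pose (I := mkC 0 1).
  assert (E : Cmul (mkC 4 0) (inner (T x) y) =
    Cadd (Cadd (B C1) (Copp (B (Copp C1)))) (Cadd (Cmul I (B I)) (Copp (Cmul I (B (Copp I)))))).
  { unfold B; rewrite !(proj1 HT), !(proj1 (proj2 HT)); inner_simpl.
    apply Cplx_ext; simpl; ring. }
  assert (E' : nsq (hadd x (hscal C1 y)) + nsq (hadd x (hscal (Copp C1) y)) +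
    nsq (hadd x (hscal I y)) + nsq (hadd x (hscal (Copp I) y)) = 4 * (nsq x + nsq y)).
  { rewrite !nsq_add, !nsq_scal, !inner_scal_r; unfold Cnorm2; simpl; ring. }
  apply (f_equal Cabs) in E; rewrite Cabs_mul, Cabs_real, Rabs_pos_eq in E by lra.
  assert (HI : Cabs I = 1).
  { unfold Cabs, Cnorm2, I; simpl; replace (0 * 0 + 1 * 1) with 1 by ring; apply sqrt_1. }
  pose proof (HB C1); pose proof (HB (Copp C1)); pose proof (HB I); pose proof (HB (Copp I)).
  assert (K : 4 * Cabs (inner (T x) y) <=
    Cabs (B C1) + Cabs (B (Copp C1)) + (Cabs (B I) + Cabs (B (Copp I)))).
  { rewrite E; eapply Rle_trans; [apply Cabs_add|]; apply Rplus_le_compat;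
      (eapply Rle_trans; [apply Cabs_add|]); rewrite !Cabs_opp, ?Cabs_mul, ?HI; lra. }
  assert (2 * w * (4 * (nsq x + nsq y)) = 2 * w * nsq (hadd x (hscal C1 y)) +
    2 * w * nsq (hadd x (hscal (Copp C1) y)) + 2 * w * nsq (hadd x (hscal I y)) +
    2 * w * nsq (hadd x (hscal (Copp I) y))) by (rewrite <- E'; ring).
  lra.
Qed.

(** The equation on y fits both the residual of Tx and Tx itself when that is orthogonal to the e_j.
    Polarization is not homogeneous, so y is rescaled by t; t = 1/(4w) gives 2 |y|^2 <= 16 w^2 |x|^2
    + |y|^2. *)
Lemma compression_bound {H : Hilbert} (T : H -> H) n (e : nat -> H) x y :
  bounded_linear T -> numerical_system T e -> perp n e x -> perp n e y ->
  inner (T x) y = inner y y -> hnorm y <= 4 * numval T (e n) * hnorm x.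
Proof.
  intros HT He Hx Hy E; set (w := numval T (e n)).
  assert (Hw : 0 <= w) by apply Cabs_ge0.
  assert (K : forall t, 0 <= t -> t * nsq y <= 2 * w * (nsq x + t * t * nsq y)).
  { intros t Ht.
    pose proof (polarization_bound T n e x (hscal (mkC t 0) y) HT He Hx
      (perp_scal n e _ y Hy)) as K; fold w in K.
    rewrite inner_scal_r, E, inner_self, nsq_scal in K.
    replace (Cmul (Cconj (mkC t 0)) (mkC (nsq y) 0)) with (mkC (t * nsq y) 0) in K
      by (apply Cplx_ext; simpl; ring).
    rewrite Cabs_real, Rabs_pos_eq in K
      by (apply Rmult_le_pos; [exact Ht|apply nsq_ge0]).
    replace (Cnorm2 (mkC t 0)) with (t * t) in K by (unfold Cnorm2; simpl; ring); exact K. }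
  apply nsq_le_hnorm; [lra|].
  destruct Hw as [Hw|Hw].
  - specialize (K (/ (4 * w)) ltac:(left; apply Rinv_0_lt_compat; lra)).
    apply Rmult_le_compat_l with (r := 8 * w) in K; [|lra].
    replace (8 * w * (/ (4 * w) * nsq y)) with (2 * nsq y) in K by (field; lra).
    replace (8 * w * (2 * w * (nsq x + / (4 * w) * / (4 * w) * nsq y)))
      with (16 * w * w * nsq x + nsq y) in K by (field; lra).
    lra.
  - specialize (K 1 ltac:(lra)); rewrite <- Hw in *; lra.
Qed.

Lemma diag_bounded_compact {H : Hilbert} (T : H -> H) (e : nat -> H) p C : 0 < p ->
  bounded_linear T -> numerical_system T e -> diag_bounded T p C -> compact_op T.
Proof.
  intros Hp HT He HC; apply compact_of_finite_rank_approx; [exact HT|]; intros eps Heps.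
  destruct (classic (exists n, 4 * numval T (e n) <= eps)) as [[n Hn]|Hno].
  - exists n, e; split; [apply He|]; intros x Hx.
    eapply Rle_trans; [apply (compression_bound T n e x)|]; auto.
    + apply resid_perp, He.
    + rewrite <- (proj_resid n e (T x)) at 1; rewrite inner_add_l, perp_proj
        by apply resid_perp, He; ring.
    + apply Rmult_le_compat_r; [apply hnorm_ge0|exact Hn].
  - exfalso.
    (* If every greedy value exceeded eps/4, N of them would contribute at least N d, which is
       unbounded in N. *)
    set (d := rpow (eps / 4) p).
    assert (Hd : 0 < d) by (apply rpow_gt0; lra).
    assert (HN : forall N, INR N * d <= C).
    { intros N; eapply Rle_trans; [|apply (numerical_values_sum T e p C He HC N)].
      rewrite <- rsum_const; apply rsum_le; intros n _; apply rpow_le; [exact Hp|lra|].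
      apply Rnot_lt_le; intros Hlt; apply Hno; exists n; lra. }
    destruct (INR_unbounded (C / d)) as [N HNgt].
    specialize (HN N); apply Rmult_gt_compat_r with (r := d) in HNgt; [|exact Hd].
    replace (C / d * d) with C in HNgt by (field; lra); lra.
Qed.

(** * Eigenvalues of the modulus against greedy values *)

(** A dimension count: asking that x and Tx be orthogonal to e_0, ..., e_(n-1) is 2n linear
    conditions, met by some nonzero x in the span of m > 2n eigenvectors. There |Tx| <= w |x| with w
    = 4 |<T e_n, e_n>|, which fails if all eigenvalues exceed w. *)
Lemma small_eigenvalue {H : Hilbert} (T A : H -> H) (e : nat -> H) n m (u : nat -> H) lam :
  bounded_linear T -> numerical_system T e -> is_abs_op T A -> (2 * n < m)%nat ->
  orthonormal m u -> (forall i, (i < m)%nat -> 0 < lam i /\ A (u i) = hscalR (lam i) (u i)) ->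
  exists i, (i < m)%nat /\ lam i <= 4 * numval T (e n).
Proof.
  intros HT He [HA [_ [_ HAA]]] Hnm Hu Hlam; apply NNPP; intros Hno.
  set (w := 4 * numval T (e n)) in *.
  assert (Hw : 0 <= w) by (pose proof (Cabs_ge0 (inner (T (e n)) (e n))); unfold w, numval; lra).
  assert (Hgt : forall i, (i < m)%nat -> w < lam i)
    by (intros i Hi; apply Rnot_le_lt; intros Hle; apply Hno; eauto).
  pose proof (orthonormal_osys m u Hu) as Ho.
  destruct (linear_system m (map (fun j i => inner (u i) (e j)) (seq 0 n) ++
    map (fun j i => inner (T (u i)) (e j)) (seq 0 n))) as [c [[i0 [Hi0 Hc]] Hsys]].
  { rewrite length_app, !length_map, length_seq; lia. }
  pose (x := hsum m (fun i => hscal (c i) (u i))).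
  assert (Hx : perp n e x).
  { intros j Hj; unfold x; rewrite inner_hsum_l.
    rewrite <- (Hsys (fun i => inner (u i) (e j))).
    - apply csum_ext; intros; apply inner_scal_l.
    - apply in_or_app; left; apply in_map_iff; exists j; split; [reflexivity|].
      apply in_seq; lia. }
  assert (HTx : perp n e (T x)).
  { intros j Hj; unfold x; rewrite linear_hsum, inner_hsum_l by exact HT.
    rewrite <- (Hsys (fun i => inner (T (u i)) (e j))).
    - apply csum_ext; intros; rewrite (proj1 (proj2 HT)); apply inner_scal_l.
    - apply in_or_app; right; apply in_map_iff; exists j; split; [reflexivity|].
      apply in_seq; lia. }
  pose proof (compression_bound T n e x (T x) HT He Hx HTx eq_refl) as K.
  fold w in K; apply hnorm_le_nsq in K.
  assert (Hux : forall i, (i < m)%nat -> inner (u i) x = Cconj (c i)).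
  { intros i Hi; rewrite inner_conj_sym; unfold x.
    rewrite inner_osys_combination, Hu by assumption.
    destruct (Nat.eq_dec i i); [|congruence]; f_equal; ring. }
  assert (Ex : nsq x = rsum m (fun i => Cnorm2 (c i))).
  { unfold nsq; unfold x at 1; rewrite inner_hsum_l, csum_re; apply rsum_ext; intros i Hi.
    rewrite inner_scal_l, Hux, Cmul_conj by exact Hi; reflexivity. }
  assert (ETx : nsq (T x) = rsum m (fun i => lam i * lam i * Cnorm2 (c i))).
  { unfold nsq; rewrite <- HAA; unfold x at 1.
    rewrite (linear_hsum A), (linear_hsum A), inner_hsum_l, csum_re by exact HA.
    apply rsum_ext; intros i Hi; destruct (Hlam i Hi) as [_ EA].
    rewrite !(proj1 (proj2 HA)), EA; unfold hscalR.
    rewrite (proj1 (proj2 HA)), EA; unfold hscalR; rewrite !inner_scal_l, Hux by exact Hi.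
    unfold Cnorm2; simpl; ring. }
  rewrite Ex, ETx, <- rsum_mul in K.
  assert (K' : rsum m (fun i => w * w * Cnorm2 (c i)) <
    rsum m (fun i => lam i * lam i * Cnorm2 (c i))).
  { assert (Hsq : forall i, (i < m)%nat -> w * w < lam i * lam i)
      by (intros i Hi; specialize (Hgt i Hi); nra).
    apply rsum_lt.
    - intros i Hi; apply Rmult_le_compat_r; [apply Cnorm2_ge0|left; auto].
    - exists i0; split; [exact Hi0|]; apply Rmult_lt_compat_r; [|auto].
      destruct (Cnorm2_ge0 (c i0)) as [|E]; [assumption|].
      exfalso; apply Hc, Cnorm2_eq0; auto. }
  lra.
Qed.

Lemma orthonormal_drop_at {H : Hilbert} m k (u : nat -> H) : (k <= m)%nat ->
  orthonormal (S m) u -> orthonormal m (drop_at m k u).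
Proof.
  intros Hk Hu i j Hi Hj; unfold drop_at; rewrite Hu.
  - destruct (Nat.eq_dec i j) as [->|Hij].
    + destruct (Nat.eq_dec _ _); [reflexivity|congruence].
    + destruct (Nat.eq_dec i k), (Nat.eq_dec j k);
        match goal with |- (if ?d then _ else _) = _ => destruct d; [lia|reflexivity] end.
  - destruct (Nat.eq_dec i k); lia.
  - destruct (Nat.eq_dec j k); lia.
Qed.

(** The eigenvalues come unsorted. Among m + 1 > 2 (m div 2) of them one is at most 4 times the
    greedy value of index m div 2; it is paired with that value and removed, and the rest goes by
    induction. *)
Lemma eigenvalue_sum_bound {H : Hilbert} (T A : H -> H) (e : nat -> H) p :
  0 < p -> bounded_linear T -> numerical_system T e -> is_abs_op T A ->
  forall m (u : nat -> H) (lam : nat -> R), orthonormal m u ->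
    (forall i, (i < m)%nat -> 0 < lam i /\ A (u i) = hscalR (lam i) (u i)) ->
    rsum m (fun i => rpow (lam i) p) <=
      rsum m (fun i => rpow (4 * numval T (e (Nat.div2 i))) p).
Proof.
  intros Hp HT He HA; induction m as [|m IH]; intros u lam Hu Hlam; [simpl; lra|].
  assert (Hdiv : (2 * Nat.div2 m < S m)%nat)
    by (pose proof (Nat.div2_odd m); destruct (Nat.odd m); simpl in *; lia).
  destruct (small_eigenvalue T A e (Nat.div2 m) (S m) u lam HT He HA Hdiv Hu Hlam)
    as [k [Hk Hle]].
  rewrite (rsum_drop_at m k) by lia; cbn [rsum]; apply Rplus_le_compat.
  - apply (IH (drop_at m k u) (drop_at m k lam)).
    + apply orthonormal_drop_at; [lia|exact Hu].
    + intros i Hi; apply Hlam; destruct (Nat.eq_dec i k); lia.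
  - apply rpow_le; [exact Hp|left; apply Hlam, Hk|exact Hle].
Qed.

Lemma Sp_of_diag_bounded {H : Hilbert} (T : H -> H) p C : 0 < p -> bounded_linear T ->
  diag_bounded T p C -> in_Sp p T.
Proof.
  intros Hp HT HC; destruct (numerical_system_exists T HT) as [e He].
  pose proof (diag_bounded_compact T e p C Hp HT He HC) as Hc.
  split; [exact Hc|].
  destruct (abs_op_exists T HT Hc) as [A HA]; exists A; split; [exact HA|].
  (* The 2 comes from each greedy value serving two eigenvalues, the 4^p from the norm bound 4w on
     compressions. *)
  exists (2 * (rpow 4 p * C)); intros m u lam Hu Hlam.
  eapply Rle_trans; [apply (eigenvalue_sum_bound T A e p Hp HT He HA m u lam Hu Hlam)|].
  eapply Rle_trans; [apply (rsum_div2 m (fun i => rpow (4 * numval T (e i)) p));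
    intros; apply rpow_ge0|].
  apply Rmult_le_compat_l; [lra|].
  rewrite (rsum_ext m _ (fun i => rpow 4 p * rpow (numval T (e i)) p))
    by (intros; apply rpow_mult; [lra|apply Cabs_ge0]).
  rewrite rsum_mul; apply Rmult_le_compat_l; [apply rpow_ge0|].
  apply numerical_values_sum; assumption.
Qed.

Theorem theorem13 (H : Hilbert) (p : R) (T : H -> H) :
  2 <= p -> bounded_linear T ->
  (in_Sp p T <->
     exists C, 0 < C /\ forall e : nat -> H, orthonormal_basis e -> double_sum_le T e p C) /\
  (in_Sp p T <->
     exists C, 0 < C /\ forall f : nat -> H,
        is_frame f -> upper_frame_bound_le f 1 -> double_sum_le T f p C).
Proof.
  intros Hp HT.
  assert (Hbasis : forall C,
    (forall e : nat -> H, orthonormal_basis e -> double_sum_le T e p C) -> in_Sp p T).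
  { intros C HC; destruct (diag_bounded_of_bases T p C ltac:(lra) HT HC) as [C' HC'].
    apply (Sp_of_diag_bounded T p C'); [lra|exact HT|exact HC']. }
  split; split.
  - intros HS; destruct (Sp_frame_bound p T Hp HT HS) as [C [HC0 HC]].
    exists C; split; [exact HC0|]; intros e He; apply HC, orthonormal_basis_frame, He.
  - intros [C [_ HC]]; exact (Hbasis C HC).
  - intros HS; destruct (Sp_frame_bound p T Hp HT HS) as [C [HC0 HC]].
    exists C; split; [exact HC0|]; intros f _ Hf; apply HC, Hf.
  - intros [C [_ HC]]; apply (Hbasis C); intros e He.
    destruct (orthonormal_basis_frame e He); apply HC; assumption.
Qed.
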